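(* Let $A$ be a non-degenerate algebra over $\mathbb C$ and let $\Delta:A\to M(A\otimes A)$ be a regular coproduct on $A$. If there exist a left faithful left integral and a right faithful right integral on $A$, then $(A,\Delta)$ is a multiplier Hopf algebra. If there exist a faithful left integral and a faithful right integral on $A$, then $(A,\Delta)$ is a regular multiplier Hopf algebra.
   Context: Algebras are associative over $\mathbb C$, not necessarily unital. $A$ is non-degenerate if for $a\in A$: $ab=0$ for all $b\in A$ implies $a=0$, and $ba=0$ for all $b\in A$ implies $a=0$. $M(A)$, $M(A\otimes A)$ are the multiplier algebras, $\otimes$ is the algebraic tensor product, $\iota$ is the identity map. Canonical maps of a linear map $\Delta:A\to M(A\otimes A)$ (from $A\otimes A$ to $M(A\otimes A)$): $T_1(a\otimes b)=\Delta(a)(1\otimes b)$, $T_2(c\otimes a)=(c\otimes 1)\Delta(a)$, $T_3(a\otimes b)=(1\otimes b)\Delta(a)$, $T_4(c\otimes a)=\Delta(a)(c\otimes 1)$. A canonical map is regular if its range lies in $A\otimes A$; $\Delta$ is regular if all four are regular. A coproduct is an algebra homomorphism $\Delta:A\to M(A\otimes A)$ (not assumed non-degenerate or full) for which one of the pairs $(T_1,T_2)$, $(T_3,T_4)$, $(T_1,T_4)$, $(T_2,T_3)$ is regular and the corresponding coassociativity holds for all $a,b,c\in A$: $(T_1,T_2)$: $(c\otimes 1\otimes 1)(\Delta\otimes\iota)(\Delta(a)(1\otimes b))=(\iota\otimes\Delta)((c\otimes 1)\Delta(a))(1\otimes 1\otimes b)$; $(T_3,T_4)$: $(\Delta\otimes\iota)((1\otimes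 b)\Delta(a))(c\otimes 1\otimes 1)=(1\otimes 1\otimes b)(\iota\otimes\Delta)(\Delta(a)(c\otimes 1))$; $(T_1,T_4)$: $(\Delta\otimes\iota)(\Delta(a)(1\otimes b))(c\otimes 1\otimes 1)=(\iota\otimes\Delta)(\Delta(a)(c\otimes 1))(1\otimes 1\otimes b)$; $(T_2,T_3)$: $(c\otimes 1\otimes 1)(\Delta\otimes\iota)((1\otimes b)\Delta(a))=(1\otimes 1\otimes b)(\iota\otimes\Delta)((c\otimes 1)\Delta(a))$. When $\Delta$ is regular all four forms are equivalent. A left integral is a non-zero linear functional $\varphi$ on $A$ with $(\iota\otimes\varphi)((c\otimes 1)\Delta(a)(c'\otimes 1))=\varphi(a)cc'$ for all $a,c,c'\in A$. A right integral is a non-zero linear functional $\psi$ on $A$ with $(\psi\otimes\iota)((1\otimes b')\Delta(a)(1\otimes b))=\psi(a)b'b$ for all $a,b,b'\in A$. A linear functional $\omega$ on $A$ is left faithful if $\omega(ab)=0$ for all $b\in A$ implies $a=0$; right faithful if $\omega(ca)=0$ for all $c\in A$ implies $a=0$; faithful if both. $(A,\Delta)$ is a multiplier Hopf algebra if $A$ is non-degenerate, $\Delta$ is a coproduct with $T_1,T_2$ regular, and $T_1,T_2$ are bijections from $A\otimes A$ to $A\otimes A$. It is a regular multiplier Hopf algebra if moreover $T_3$ and $T_4$ are regular and are bijections from $A\otimes A$ to $A\otimes A$. *)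

(* Defs.v *)
From HB Require Import structures.
From mathcomp Require Import all_boot all_algebra.
From mathcomp Require Import boolp.
Set Implicit Arguments.
Unset Strict Implicit.
Unset Printing Implicit Defensive.
Import GRing.Theory.
Local Open Scope ring_scope.
Local Open Scope quotient_scope.

Reserved Notation "x ** y" (at level 40, left associativity).
Reserved Notation "a *t b" (at level 40, left associativity).
Reserved Notation "m *M n" (at level 40, left associativity).


HB.mixin Record Lmodule_isNonUnitalAlgebra (K : fieldType) A
    of GRing.Lmodule K A := {
  nmul : A -> A -> A;
  nmulA : associative nmul;
  nmul_linearl : forall y, linear (nmul^~ y);
  nmul_linearr : forall x, linear (nmul x)
}.

#[short(type="nonUnitalAlgType")]
HB.structure Definition NonUnitalAlgebra (K : fieldType) :=
  { A of GRing.Lmodule K A & Lmodule_isNonUnitalAlgebra K A }.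

Notation "x ** y" := (nmul x y) : ring_scope.

Definition bilinear_map (K : fieldType) (U V W : lmodType K)
    (f : U -> V -> W) : Prop :=
  (forall v, linear (f^~ v)) /\ (forall u, linear (f u)).

Lemma nmul_bilinear (K : fieldType) (A : nonUnitalAlgType K) :
  bilinear_map (@nmul K A).
Proof. by split; [exact: nmul_linearl | exact: nmul_linearr]. Qed.

Section BilinearTheory.
Variables (K : fieldType) (U V W : lmodType K) (f : U -> V -> W).
Hypothesis hf : bilinear_map f.

Lemma bilinearDl u u' v : f (u + u') v = f u v + f u' v.
Proof. by have := hf.1 v 1 u u'; rewrite !scale1r. Qed.
Lemma bilinearDr u v v' : f u (v + v') = f u v + f u v'.
Proof. by have := hf.2 u 1 v v'; rewrite !scale1r. Qed.
Lemma bilinear0l v : f 0 v = 0.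
Proof. by apply: (addrI (f 0 v)); rewrite -bilinearDl !addr0. Qed.
Lemma bilinear0r u : f u 0 = 0.
Proof. by apply: (addrI (f u 0)); rewrite -bilinearDr !addr0. Qed.
Lemma bilinearZl k u v : f (k *: u) v = k *: f u v.
Proof. by have := hf.1 v k u 0; rewrite /= bilinear0l !addr0. Qed.
Lemma bilinearZr k u v : f u (k *: v) = k *: f u v.
Proof. by have := hf.2 u k v 0; rewrite /= bilinear0r !addr0. Qed.

End BilinearTheory.

Section LinearTheory.
Variables (K : fieldType) (U V : lmodType K) (f : U -> V).
Hypothesis hf : linear f.

Lemma linear_funD u u' : f (u + u') = f u + f u'.
Proof. by have := hf 1 u u'; rewrite !scale1r. Qed.
Lemma linear_fun0 : f 0 = 0.
Proof. by apply: (addrI (f 0)); rewrite -linear_funD !addr0. Qed.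
Lemma linear_funZ k u : f (k *: u) = k *: f u.
Proof. by have := hf k u 0; rewrite linear_fun0 !addr0. Qed.

End LinearTheory.

Lemma linear_comp (K : fieldType) (U V W : lmodType K)
    (f : V -> W) (g : U -> V) : linear f -> linear g -> linear (f \o g).
Proof. by move=> hf hg k x y /=; rewrite hg hf. Qed.


(* The word [:: (a1, b1); ...; (an, bn)] stands for the finite sum of the
   a_i (x) b_i; scalars are absorbed in the first factor.  The tensor product
   is the quotient of the words by the congruence generated by the
   commutativity of the sum and the bilinearity relations. *)
Inductive tensor_rel (K : fieldType) (U V : lmodType K) :
    seq (U * V) -> seq (U * V) -> Prop :=
| TensorRefl s : tensor_rel s s
| TensorSym s t : tensor_rel s t -> tensor_rel t s
| TensorTrans s t u : tensor_rel s t -> tensor_rel t u -> tensor_rel s u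
| TensorCat s s' t t' :
    tensor_rel s s' -> tensor_rel t t' -> tensor_rel (s ++ t) (s' ++ t')
| TensorComm s t : tensor_rel (s ++ t) (t ++ s)
| Tensor0 v : tensor_rel [:: (0, v)] [::]
| TensorDl u u' v : tensor_rel [:: (u + u', v)] [:: (u, v); (u', v)]
| TensorDr u v v' : tensor_rel [:: (u, v + v')] [:: (u, v); (u, v')]
| TensorZ k u v : tensor_rel [:: (k *: u, v)] [:: (u, k *: v)].

Section Tensor.
Variables (K : fieldType) (U V : lmodType K).
Implicit Types s t : seq (U * V).

Definition tensor_relb s t : bool := `[< tensor_rel s t >].

Lemma tensor_relb_equiv : equiv_class_of tensor_relb.
Proof.
split=> [s|s t|t s u].
- by apply/asboolP; exact: TensorRefl.
- by apply/asboolP/asboolP; exact: TensorSym.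
- by move=> /asboolP st /asboolP tu; apply/asboolP; exact: TensorTrans st tu.
Qed.

Canonical tensor_equiv := EquivRelPack tensor_relb_equiv.

Definition tensor := {eq_quot tensor_equiv}.

HB.instance Definition _ : EqQuotient _ tensor_equiv tensor :=
  EqQuotient.on tensor.
HB.instance Definition _ := Choice.on tensor.

Definition word (s : seq (U * V)) : tensor := \pi_tensor s.

Lemma wordP s t : word s = word t <-> tensor_rel s t.
Proof.
split=> [/eqquotP/asboolP //|st].
by apply/eqquotP/asboolP.
Qed.

Lemma wordW (P : tensor -> Prop) : (forall s, P (word s)) -> forall x, P x.
Proof. by move=> h x; rewrite -[x]reprK; exact: h. Qed.

Lemma repr_wordP s : tensor_rel (repr (word s)) s.
Proof. by apply/wordP; rewrite /word reprK. Qed.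

Definition tadd (x y : tensor) : tensor := word (repr x ++ repr y).
Definition tscale (k : K) (x : tensor) : tensor :=
  word [seq (k *: p.1, p.2) | p <- repr x].
Definition topp (x : tensor) : tensor := tscale (-1) x.

Lemma tadd_word s t : tadd (word s) (word t) = word (s ++ t).
Proof. by apply/wordP; apply: TensorCat; exact: repr_wordP. Qed.

Lemma tensor_rel_scale k s t : tensor_rel s t ->
  tensor_rel [seq (k *: p.1, p.2) | p <- s] [seq (k *: p.1, p.2) | p <- t].
Proof.
elim=> {s t} /=.
- by move=> s; exact: TensorRefl.
- by move=> s t _; exact: TensorSym.
- by move=> s t u _ st _; exact: TensorTrans.
- by move=> s s' t t' _ ss' _ tt'; rewrite !map_cat; exact: TensorCat.
- by move=> s t; rewrite !map_cat; exact: TensorComm.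
- by move=> v; rewrite scaler0; exact: Tensor0.
- by move=> u u' v; rewrite scalerDr; exact: TensorDl.
- by move=> u v v'; exact: TensorDr.
- by move=> l u v; rewrite scalerA mulrC -scalerA; exact: TensorZ.
Qed.

Lemma tscale_word k s : tscale k (word s) = word [seq (k *: p.1, p.2) | p <- s].
Proof. by apply/wordP; apply: tensor_rel_scale; exact: repr_wordP. Qed.

Lemma taddA : associative tadd.
Proof.
by elim/wordW=> s; elim/wordW=> t; elim/wordW=> u; rewrite !tadd_word catA.
Qed.

Lemma taddC : commutative tadd.
Proof.
elim/wordW=> s; elim/wordW=> t; rewrite !tadd_word.
by apply/wordP; exact: TensorComm.
Qed.

Lemma tadd0 : left_id (word [::]) tadd.
Proof. by elim/wordW=> s; rewrite tadd_word. Qed.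

Lemma taddN : left_inverse (word [::]) topp tadd.
Proof.
elim/wordW=> s; rewrite /topp tscale_word.
elim: s => [|[u v] s ih]; first by rewrite tadd_word.
rewrite map_cons -cat1s -[(u, v) :: s]cat1s -!tadd_word [tadd (word [:: (u, v)]) _]taddC.
rewrite -taddA [X in tadd _ X]taddA ih tadd0 tadd_word /=.
apply/wordP; apply: TensorTrans (TensorSym (TensorDl _ _ _)) _.
by rewrite scaleN1r addNr; exact: Tensor0.
Qed.

HB.instance Definition _ := GRing.isZmodule.Build tensor taddA taddC tadd0 taddN.

Lemma word_cat s t : word (s ++ t) = word s + word t.
Proof. by rewrite -tadd_word. Qed.

Lemma tscaleA a b x : tscale a (tscale b x) = tscale (a * b) x.
Proof.
elim/wordW: x => s; rewrite !tscale_word -map_comp.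
by congr word; apply: eq_map => p /=; rewrite scalerA.
Qed.

Lemma tscale1 : left_id 1 tscale.
Proof.
elim/wordW=> s; rewrite tscale_word -[in RHS](map_id s).
by congr word; apply: eq_map => -[u v] /=; rewrite scale1r.
Qed.

Lemma tscaleDr : right_distributive tscale +%R.
Proof.
move=> k; elim/wordW=> s; elim/wordW=> t.
by rewrite -word_cat !tscale_word map_cat word_cat.
Qed.

Lemma tscaleDl x : {morph tscale^~ x : a b / a + b}.
Proof.
move=> a b; elim/wordW: x => s; rewrite !tscale_word.
elim: s => [|[u v] s ih] /=; first by rewrite [word [::]](_ : _ = 0) // addr0.
rewrite -cat1s word_cat ih -[(a *: u, v) :: _]cat1s -[(b *: u, v) :: _]cat1s.
rewrite !word_cat addrACA; congr (_ + _); rewrite -word_cat.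
by apply/wordP; rewrite scalerDl; exact: TensorDl.
Qed.

HB.instance Definition _ :=
  GRing.Zmodule_isLmodule.Build K tensor tscaleA tscale1 tscaleDr tscaleDl.

Definition tens (u : U) (v : V) : tensor := word [:: (u, v)].

Notation "a *t b" := (tens a b) : ring_scope.

Lemma tens_bilinear : bilinear_map tens.
Proof.
have sc k s : k *: word s = word [seq (k *: p.1, p.2) | p <- s].
  exact: tscale_word.
split=> [v k u u'|u k v v'] /=.
  rewrite /tens sc -word_cat; apply/wordP; exact: TensorDl.
rewrite /tens sc -word_cat; apply/wordP.
apply: TensorTrans (TensorDr _ _ _) _.
rewrite -cat1s; apply: TensorCat; last exact: TensorRefl.
by apply: TensorSym; exact: TensorZ.
Qed.

Lemma tensor_ind (P : tensor -> Prop) :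
  (forall u v, P (u *t v)) -> (forall x y, P x -> P y -> P (x + y)) ->
  forall x, P x.
Proof.
move=> Pt PD; elim/wordW; elim=> [|[u v] s ih].
  suff -> : word [::] = 0 *t 0 by exact: Pt.
  by apply/wordP/TensorSym; exact: Tensor0.
by rewrite -cat1s word_cat; apply: PD => //; exact: Pt.
Qed.

Lemma tensor_ext (W : lmodType K) (f g : tensor -> W) : linear f -> linear g ->
  (forall u v, f (u *t v) = g (u *t v)) -> f =1 g.
Proof.
move=> hf hg fg; elim/tensor_ind => // x y fx fy.
by rewrite (linear_funD hf) (linear_funD hg) fx fy.
Qed.

(* The universal property of the tensor product (see tliftE, tlift_linear and
   tensor_ext); the value is only meaningful for a bilinear f. *)
Definition tlift (W : lmodType K) (f : U -> V -> W) (x : tensor) : W :=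
  \sum_(p <- repr x) f p.1 p.2.

Section Lift.
Variables (W : lmodType K) (f : U -> V -> W).
Hypothesis hf : bilinear_map f.

Lemma tensor_rel_sum s t : tensor_rel s t ->
  \sum_(p <- s) f p.1 p.2 = \sum_(p <- t) f p.1 p.2.
Proof.
elim=> {s t} //.
- by move=> s t u _ -> _ ->.
- by move=> s s' t t' _ ih _ ih'; rewrite !big_cat /= ih ih'.
- by move=> s t; rewrite !big_cat /= addrC.
- by move=> v; rewrite big_seq1 big_nil /= (bilinear0l hf).
- by move=> u u' v; rewrite !big_cons !big_nil !addr0 /= (bilinearDl hf).
- by move=> u v v'; rewrite !big_cons !big_nil !addr0 /= (bilinearDr hf).
- by move=> k u v; rewrite !big_seq1 /= (bilinearZl hf) (bilinearZr hf).
Qed.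

Lemma tlift_word s : tlift f (word s) = \sum_(p <- s) f p.1 p.2.
Proof. exact: tensor_rel_sum (repr_wordP s). Qed.

Lemma tliftE u v : tlift f (u *t v) = f u v.
Proof. by rewrite tlift_word big_seq1. Qed.

Lemma tlift_linear : linear (tlift f).
Proof.
move=> k; elim/wordW=> s; elim/wordW=> t.
have -> : k *: word s = word [seq (k *: p.1, p.2) | p <- s] by exact: tscale_word.
rewrite -word_cat !tlift_word big_cat /= big_map scaler_sumr.
by congr (_ + _); apply: eq_bigr => p _; rewrite /= (bilinearZl hf).
Qed.

End Lift.

End Tensor.

Notation "a *t b" := (tens a b) : ring_scope.

Section TensorMaps.
Variable K : fieldType.

Lemma tlift_bilinear (U V V' W W' : lmodType K) (f : U -> V -> V' -> W -> W') :
  (forall v' w, bilinear_map (fun u v => f u v v' w)) ->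
  (forall u v, bilinear_map (f u v)) ->
  bilinear_map (fun (x : tensor U V) (y : tensor V' W) =>
    tlift (fun u v => tlift (f u v) y) x).
Proof.
move=> f12 f34.
have hb y : bilinear_map (fun u v => tlift (f u v) y).
  split=> [v k u u' /=|u k v v'].
    elim/tensor_ind: y => [v' w|x y hx hy].
      by rewrite !tliftE //; exact: (f12 v' w).1.
    rewrite !(linear_funD (tlift_linear _)) // hx hy scalerDr.
    by rewrite !addrA -!addrA; congr (_ + _); rewrite addrCA.
  elim/tensor_ind: y => [v'' w|x y hx hy].
    by rewrite !tliftE //; exact: (f12 v'' w).2.
  rewrite !(linear_funD (tlift_linear _)) // hx hy scalerDr.
  by rewrite !addrA -!addrA; congr (_ + _); rewrite addrCA.
split=> [y|x k y y']; first exact: tlift_linear.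
elim/tensor_ind: x => [u v|x x' hx hx'].
  by rewrite !tliftE //; exact: tlift_linear.
rewrite !(linear_funD (tlift_linear _)) // hx hx' scalerDr.
by rewrite !addrA -!addrA; congr (_ + _); rewrite addrCA.
Qed.

Definition tmap (U V U' V' : lmodType K) (f : U -> U') (g : V -> V') :
    tensor U V -> tensor U' V' :=
  tlift (fun u v => f u *t g v).

Section TmapTheory.
Variables (U V U' V' : lmodType K) (f : U -> U') (g : V -> V').
Hypotheses (hf : linear f) (hg : linear g).

Lemma tmap_bilinear : bilinear_map (fun u v => f u *t g v).
Proof.
split=> [v k u u'|u k v v'] /=; [rewrite hf|rewrite hg].
  exact: (tens_bilinear _ _).1.
exact: (tens_bilinear _ _).2.
Qed.

Lemma tmapE u v : tmap f g (u *t v) = f u *t g v.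
Proof. exact: tliftE tmap_bilinear _ _. Qed.

Lemma tmap_linear : linear (tmap f g).
Proof. exact: tlift_linear tmap_bilinear. Qed.

End TmapTheory.

Definition tassoc (U V W : lmodType K) :
    tensor U (tensor V W) -> tensor (tensor U V) W :=
  tlift (fun u => tlift (fun v w => (u *t v) *t w)).

Definition tassocV (U V W : lmodType K) :
    tensor (tensor U V) W -> tensor U (tensor V W) :=
  tlift (fun x w => tlift (fun u v => u *t (v *t w)) x).

Section AssocTheory.
Variables U V W : lmodType K.

Lemma tassoc_bilinear1 (u : U) :
  bilinear_map (fun (v : V) (w : W) => (u *t v) *t w).
Proof.
split=> [w k v v'|v k w w'] /=.
  by rewrite (tens_bilinear _ _).2; exact: (tens_bilinear _ _).1.
exact: (tens_bilinear _ _).2.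
Qed.

Lemma tassoc_bilinear2 :
  bilinear_map (fun u : U => tlift (fun (v : V) (w : W) => (u *t v) *t w)).
Proof.
split=> [x k u u'|u]; last exact: tlift_linear (tassoc_bilinear1 u).
elim/tensor_ind: x => [v w|x y hx hy] /=.
  rewrite !(tliftE (tassoc_bilinear1 _)) (tens_bilinear _ _).1.
  exact: (tens_bilinear _ _).1.
rewrite /= in hx hy.
rewrite !(linear_funD (tlift_linear (tassoc_bilinear1 _))) hx hy scalerDr.
by rewrite !addrA -!addrA; congr (_ + _); rewrite addrCA.
Qed.

Lemma tassocE (u : U) (v : V) (w : W) :
  tassoc (u *t (v *t w)) = (u *t v) *t w.
Proof.
by rewrite /tassoc (tliftE tassoc_bilinear2) (tliftE (tassoc_bilinear1 u)).
Qed.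

Lemma tassoc_linear : linear (@tassoc U V W).
Proof. exact: tlift_linear tassoc_bilinear2. Qed.

Lemma tassocV_bilinear1 (w : W) :
  bilinear_map (fun (u : U) (v : V) => u *t (v *t w)).
Proof.
split=> [v k u u'|u k v v'] /=.
  exact: (tens_bilinear _ _).1.
by rewrite (tens_bilinear _ _).1; exact: (tens_bilinear _ _).2.
Qed.

Lemma tassocV_bilinear2 :
  bilinear_map (fun (x : tensor U V) (w : W) =>
    tlift (fun u v => u *t (v *t w)) x).
Proof.
split=> [w|x k w w'] /=; first exact: tlift_linear (tassocV_bilinear1 w).
elim/tensor_ind: x => [u v|x y hx hy] /=.
  rewrite !(tliftE (tassocV_bilinear1 _)) (tens_bilinear _ _).2.
  exact: (tens_bilinear _ _).2.
rewrite !(linear_funD (tlift_linear (tassocV_bilinear1 _))) hx hy scalerDr.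
by rewrite !addrA -!addrA; congr (_ + _); rewrite addrCA.
Qed.

Lemma tassocVE (u : U) (v : V) (w : W) :
  tassocV ((u *t v) *t w) = u *t (v *t w).
Proof.
by rewrite /tassocV (tliftE tassocV_bilinear2) (tliftE (tassocV_bilinear1 w)).
Qed.

Lemma tassocV_linear : linear (@tassocV U V W).
Proof. exact: tlift_linear tassocV_bilinear2. Qed.

Lemma tassocK : cancel (@tassoc U V W) (@tassocV U V W).
Proof.
elim/tensor_ind=> [u x|x y hx hy].
  elim/tensor_ind: x => [v w|x y hx hy]; first by rewrite tassocE tassocVE.
  rewrite (bilinearDr (tens_bilinear _ _)).
  by rewrite (linear_funD tassoc_linear) (linear_funD tassocV_linear) hx hy.
by rewrite (linear_funD tassoc_linear) (linear_funD tassocV_linear) hx hy.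
Qed.

Lemma tassocVK : cancel (@tassocV U V W) (@tassoc U V W).
Proof.
elim/tensor_ind=> [x w|x y hx hy].
  elim/tensor_ind: x => [u v|x y hx hy]; first by rewrite tassocVE tassocE.
  rewrite (bilinearDl (tens_bilinear _ _)).
  by rewrite (linear_funD tassocV_linear) (linear_funD tassoc_linear) hx hy.
by rewrite (linear_funD tassocV_linear) (linear_funD tassoc_linear) hx hy.
Qed.

End AssocTheory.
End TensorMaps.

Section TensorAlgebra.
Variables (K : fieldType) (A B : nonUnitalAlgType K).

Definition tmul (x y : tensor A B) : tensor A B :=
  tlift (fun a b => tlift (fun a' b' => (a ** a') *t (b ** b')) y) x.

Lemma tmul_bilinear1 a b :
  bilinear_map (fun (a' : A) (b' : B) => (a ** a') *t (b ** b')).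
Proof. by apply: tmap_bilinear; exact: nmul_linearr. Qed.

Lemma tmul_bilinear2 a' b' :
  bilinear_map (fun (a : A) (b : B) => (a ** a') *t (b ** b')).
Proof.
by apply: (@tmap_bilinear _ _ _ _ _ (nmul^~ a') (nmul^~ b')); exact: nmul_linearl.
Qed.

Lemma tmul_bilinear : bilinear_map tmul.
Proof.
apply: (@tlift_bilinear _ _ _ _ _ _
  (fun a b a' b' => (a ** a') *t (b ** b'))).
  exact: tmul_bilinear2.
exact: tmul_bilinear1.
Qed.

Lemma tmulE a b a' b' : tmul (a *t b) (a' *t b') = (a ** a') *t (b ** b').
Proof.
rewrite /tmul tliftE; first exact: tliftE (tmul_bilinear1 a b) _ _.
split=> [d k c c'|c k d d'] /=; elim/tensor_ind: (a' *t b') => [u v|x y].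
- by rewrite !(tliftE (tmul_bilinear1 _ _)); exact: (tmul_bilinear2 u v).1.
- rewrite !(linear_funD (tlift_linear (tmul_bilinear1 _ _))) => -> ->.
  by rewrite scalerDr !addrA -!addrA; congr (_ + _); rewrite addrCA.
- by rewrite !(tliftE (tmul_bilinear1 _ _)); exact: (tmul_bilinear2 u v).2.
- rewrite !(linear_funD (tlift_linear (tmul_bilinear1 _ _))) => -> ->.
  by rewrite scalerDr !addrA -!addrA; congr (_ + _); rewrite addrCA.
Qed.

Lemma tmulA : associative tmul.
Proof.
have Dl := bilinearDl tmul_bilinear; have Dr := bilinearDr tmul_bilinear.
move=> x y z; elim/tensor_ind: x => [a b|x x' hx hx']; last first.
  by rewrite !Dl hx hx'.
elim/tensor_ind: y => [a' b'|y y' hy hy']; last by rewrite Dr !Dl Dr hy hy'.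
elim/tensor_ind: z => [a'' b''|z z' hz hz']; last by rewrite !Dr hz hz'.
by rewrite !tmulE !nmulA.
Qed.

HB.instance Definition _ :=
  Lmodule_isNonUnitalAlgebra.Build K (tensor A B)
    tmulA tmul_bilinear.1 tmul_bilinear.2.

Lemma tens_mul (a a' : A) (b b' : B) :
  (a *t b) ** (a' *t b') = (a ** a') *t (b ** b').
Proof. exact: tmulE. Qed.

End TensorAlgebra.


(* A multiplier m acts on the left by lact m x = m x and on the right by
   ract m x = x m. *)
Record multiplier (K : fieldType) (B : nonUnitalAlgType K) := Multiplier {
  lact : B -> B;
  ract : B -> B;
  lact_linear : linear lact;
  ract_linear : linear ract;
  lactM : forall x y, lact (x ** y) = lact x ** y;
  ractM : forall x y, ract (x ** y) = x ** ract y;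
  ract_lact : forall x y, x ** lact y = ract x ** y
}.

HB.instance Definition _ (K : fieldType) (B : nonUnitalAlgType K) :=
  gen_eqMixin (multiplier B).
HB.instance Definition _ (K : fieldType) (B : nonUnitalAlgType K) :=
  gen_choiceMixin (multiplier B).

Section MultiplierAlgebra.
Variables (K : fieldType) (B : nonUnitalAlgType K).
Implicit Types m n : multiplier B.

Lemma multiplierP m n : lact m =1 lact n -> ract m =1 ract n -> m = n.
Proof.
case: m n => [l r h1 h2 h3 h4 h5] [l' r' h1' h2' h3' h4' h5'] /=.
move=> /funext ll /funext rr; subst l' r'.
by congr Multiplier; exact: Prop_irrelevance.
Qed.

Let mulDl := bilinearDl (@nmul_bilinear K B).
Let mulDr := bilinearDr (@nmul_bilinear K B).
Let mulZl := bilinearZl (@nmul_bilinear K B).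
Let mulZr := bilinearZr (@nmul_bilinear K B).

Program Definition mult0 : multiplier B :=
  @Multiplier K B (fun=> 0) (fun=> 0) _ _ _ _ _.
Next Obligation. by move=> k x y; rewrite scaler0 addr0. Qed.
Next Obligation. by move=> k x y; rewrite scaler0 addr0. Qed.
Next Obligation. by rewrite (bilinear0l (@nmul_bilinear K B)). Qed.
Next Obligation. by rewrite (bilinear0r (@nmul_bilinear K B)). Qed.
Next Obligation.
by rewrite (bilinear0l (@nmul_bilinear K B)) (bilinear0r (@nmul_bilinear K B)).
Qed.

Program Definition mult_add m n : multiplier B :=
  @Multiplier K B (fun x => lact m x + lact n x) (fun x => ract m x + ract n x)
    _ _ _ _ _.
Next Obligation.
by move=> k x y; rewrite !lact_linear scalerDr addrACA.
Qed.
Next Obligation.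
by move=> k x y; rewrite !ract_linear scalerDr addrACA.
Qed.
Next Obligation. by rewrite !lactM mulDl. Qed.
Next Obligation. by rewrite !ractM mulDr. Qed.
Next Obligation. by rewrite mulDl mulDr !ract_lact. Qed.

Program Definition mult_scale (k : K) m : multiplier B :=
  @Multiplier K B (fun x => k *: lact m x) (fun x => k *: ract m x) _ _ _ _ _.
Next Obligation.
by move=> l x y; rewrite lact_linear scalerDr !scalerA mulrC.
Qed.
Next Obligation.
by move=> l x y; rewrite ract_linear scalerDr !scalerA mulrC.
Qed.
Next Obligation. by rewrite lactM mulZl. Qed.
Next Obligation. by rewrite ractM mulZr. Qed.
Next Obligation. by rewrite mulZl mulZr ract_lact. Qed.

Definition mult_opp m : multiplier B := mult_scale (-1) m.

Program Definition mult_one : multiplier B :=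
  @Multiplier K B id id _ _ _ _ _.
Next Obligation. by []. Qed.
Next Obligation. by []. Qed.

Program Definition mult_mul m n : multiplier B :=
  @Multiplier K B (lact m \o lact n) (ract n \o ract m) _ _ _ _ _.
Next Obligation. by apply: linear_comp; exact: lact_linear. Qed.
Next Obligation. by apply: linear_comp; exact: ract_linear. Qed.
Next Obligation. by rewrite !lactM. Qed.
Next Obligation. by rewrite !ractM. Qed.
Next Obligation. by rewrite !ract_lact. Qed.

Lemma mult_addA : associative mult_add.
Proof. by move=> m n p; apply: multiplierP => x /=; rewrite addrA. Qed.
Lemma mult_addC : commutative mult_add.
Proof. by move=> m n; apply: multiplierP => x /=; rewrite addrC. Qed.
Lemma mult_add0 : left_id mult0 mult_add.
Proof. by move=> m; apply: multiplierP => x /=; rewrite add0r. Qed.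
Lemma mult_addN : left_inverse mult0 mult_opp mult_add.
Proof. by move=> m; apply: multiplierP => x /=; rewrite scaleN1r addNr. Qed.

HB.instance Definition _ :=
  GRing.isZmodule.Build (multiplier B) mult_addA mult_addC mult_add0 mult_addN.

Lemma mult_scaleA a b m :
  mult_scale a (mult_scale b m) = mult_scale (a * b) m.
Proof. by apply: multiplierP => x /=; rewrite scalerA. Qed.
Lemma mult_scale1 : left_id 1 mult_scale.
Proof. by move=> m; apply: multiplierP => x /=; rewrite scale1r. Qed.
Lemma mult_scaleDr : right_distributive mult_scale +%R.
Proof. by move=> k m n; apply: multiplierP => x /=; rewrite scalerDr. Qed.
Lemma mult_scaleDl m : {morph mult_scale^~ m : a b / a + b}.
Proof. by move=> a b; apply: multiplierP => x /=; rewrite scalerDl. Qed.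

HB.instance Definition _ := GRing.Zmodule_isLmodule.Build K (multiplier B)
  mult_scaleA mult_scale1 mult_scaleDr mult_scaleDl.

Lemma mult_mulA : associative mult_mul.
Proof. by move=> m n p; apply: multiplierP. Qed.
Lemma mult_mul1l : left_id mult_one mult_mul.
Proof. by move=> m; apply: multiplierP. Qed.
Lemma mult_mul1r : right_id mult_one mult_mul.
Proof. by move=> m; apply: multiplierP. Qed.
Lemma mult_mulDl : left_distributive mult_mul +%R.
Proof.
move=> m n p; apply: multiplierP => x //=.
by rewrite (linear_funD (ract_linear p)).
Qed.
Lemma mult_mulDr : right_distributive mult_mul +%R.
Proof.
move=> m n p; apply: multiplierP => x //=.
by rewrite (linear_funD (lact_linear m)).
Qed.

HB.instance Definition _ := GRing.Zmodule_isPzRing.Build (multiplier B)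
  mult_mulA mult_mul1l mult_mul1r mult_mulDl mult_mulDr.

(* The canonical homomorphism from B to M(B); it is injective when B is
   non-degenerate. *)
Program Definition inM (b : B) : multiplier B :=
  @Multiplier K B (nmul b) (nmul^~ b) _ _ _ _ _.
Next Obligation. exact: nmul_linearr. Qed.
Next Obligation. exact: nmul_linearl. Qed.
Next Obligation. by rewrite nmulA. Qed.
Next Obligation. by rewrite nmulA. Qed.
Next Obligation. by rewrite nmulA. Qed.

Lemma inM_linear : linear inM.
Proof.
move=> k x y; apply: multiplierP => z /=; first exact: nmul_linearl.
exact: nmul_linearr.
Qed.

Lemma inM_mul x y : inM (x ** y) = inM x * inM y.
Proof. by apply: multiplierP => z /=; rewrite nmulA. Qed.

End MultiplierAlgebra.

Section MultiplierTensor.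
Variable K : fieldType.

Section Tensor2.
Variables A B : nonUnitalAlgType K.

Let tmulDl := bilinearDl (@nmul_bilinear K (tensor A B)).
Let tmulDr := bilinearDr (@nmul_bilinear K (tensor A B)).

Program Definition mtens (m : multiplier A) (n : multiplier B) :
    multiplier (tensor A B) :=
  @Multiplier K (tensor A B) (tmap (lact m) (lact n)) (tmap (ract m) (ract n))
    _ _ _ _ _.
Next Obligation. by apply: tmap_linear; exact: lact_linear. Qed.
Next Obligation. by apply: tmap_linear; exact: ract_linear. Qed.
Next Obligation.
have D := linear_funD (tmap_linear (lact_linear m) (lact_linear n)).
elim/tensor_ind: x => [a b|x x' hx hx']; last by rewrite tmulDl !D hx hx' tmulDl.
elim/tensor_ind: y => [a' b'|y y' hy hy']; last by rewrite !tmulDr D hy hy'.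
by rewrite tens_mul !tmapE ?tens_mul ?lactM //; exact: lact_linear.
Qed.
Next Obligation.
have D := linear_funD (tmap_linear (ract_linear m) (ract_linear n)).
elim/tensor_ind: x => [a b|x x' hx hx']; last by rewrite !tmulDl D hx hx'.
elim/tensor_ind: y => [a' b'|y y' hy hy']; last by rewrite tmulDr !D hy hy' tmulDr.
by rewrite tens_mul !tmapE ?tens_mul ?ractM //; exact: ract_linear.
Qed.
Next Obligation.
have Dl := linear_funD (tmap_linear (lact_linear m) (lact_linear n)).
have Dr := linear_funD (tmap_linear (ract_linear m) (ract_linear n)).
elim/tensor_ind: x => [a b|x x' hx hx']; last by rewrite Dr !tmulDl hx hx'.
elim/tensor_ind: y => [a' b'|y y' hy hy']; last by rewrite Dl !tmulDr hy hy'.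
rewrite (tmapE (lact_linear m) (lact_linear n)).
by rewrite (tmapE (ract_linear m) (ract_linear n)) !tens_mul !ract_lact.
Qed.

Notation "m *M n" := (mtens m n) : ring_scope.

Lemma mtens_bilinear : bilinear_map mtens.
Proof.
have hl (m : multiplier A) (n : multiplier B) :=
  tmapE (lact_linear m) (lact_linear n).
have hr (m : multiplier A) (n : multiplier B) :=
  tmapE (ract_linear m) (ract_linear n).
have ext (m n : multiplier (tensor A B)) :
    (forall a b, lact m (a *t b) = lact n (a *t b)) ->
    (forall a b, ract m (a *t b) = ract n (a *t b)) -> m = n.
  move=> h h'; apply: multiplierP.
    by apply: tensor_ext h; exact: lact_linear.
  by apply: tensor_ext h'; exact: ract_linear.
split=> [n k m m'|m k n n']; apply: ext => a b.
- by apply: etrans (hl _ _ _ _) _; rewrite /= !hl; exact: (tens_bilinear _ _).1.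
- by apply: etrans (hr _ _ _ _) _; rewrite /= !hr; exact: (tens_bilinear _ _).1.
- by apply: etrans (hl _ _ _ _) _; rewrite /= !hl; exact: (tens_bilinear _ _).2.
- by apply: etrans (hr _ _ _ _) _; rewrite /= !hr; exact: (tens_bilinear _ _).2.
Qed.

Lemma mtens_inM a b : inM a *M inM b = inM (a *t b).
Proof.
apply: multiplierP.
  apply: tensor_ext => [||u v]; try exact: lact_linear.
  rewrite [RHS]tens_mul.
  by rewrite /= (tmapE (lact_linear (inM a)) (lact_linear (inM b))).
apply: tensor_ext => [||u v]; try exact: ract_linear.
rewrite [RHS]tens_mul.
by rewrite /= (tmapE (ract_linear (inM a)) (ract_linear (inM b))).
Qed.

End Tensor2.

Section Associator.
Variables A B C : nonUnitalAlgType K.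

Lemma tassocM : {morph @tassoc K A B C : x y / x ** y}.
Proof.
have D := linear_funD (@tassoc_linear K A B C).
have Dl (U : nonUnitalAlgType K) := bilinearDl (@nmul_bilinear K U).
have Dr (U : nonUnitalAlgType K) := bilinearDr (@nmul_bilinear K U).
have tDr (U V : lmodType K) := bilinearDr (@tens_bilinear K U V).
elim/tensor_ind=> [a z|x x' hx hx'] y; last by rewrite Dl !D hx hx' Dl.
elim/tensor_ind: z => [b c|x x' hx hx']; last by rewrite tDr Dl !D hx hx' Dl.
elim/tensor_ind: y => [a' z|y y' hy hy']; last by rewrite Dr !D hy hy' Dr.
elim/tensor_ind: z => [b' c'|y y' hy hy']; last by rewrite tDr Dr !D hy hy' Dr.
by rewrite !(tassocE, tens_mul).
Qed.

Lemma tassocVM : {morph @tassocV K A B C : x y / x ** y}.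
Proof.
by move=> x y; apply: (can_inj (@tassocK K A B C)); rewrite tassocM !tassocVK.
Qed.

(* Transport of multipliers along A (x) (B (x) C) = (A (x) B) (x) C. *)
Program Definition massoc (m : multiplier (tensor A (tensor B C))) :
    multiplier (tensor (tensor A B) C) :=
  @Multiplier K (tensor (tensor A B) C)
    (@tassoc K A B C \o lact m \o @tassocV K A B C)
    (@tassoc K A B C \o ract m \o @tassocV K A B C) _ _ _ _ _.
Next Obligation.
apply: linear_comp; last exact: tassocV_linear.
by apply: linear_comp; [exact: tassoc_linear | exact: lact_linear].
Qed.
Next Obligation.
apply: linear_comp; last exact: tassocV_linear.
by apply: linear_comp; [exact: tassoc_linear | exact: ract_linear].
Qed.
Next Obligation. by rewrite tassocVM lactM tassocM tassocVK. Qed.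
Next Obligation. by rewrite tassocVM ractM tassocM tassocVK. Qed.
Next Obligation.
rewrite -[x in LHS](@tassocVK K A B C) -[y in RHS](@tassocVK K A B C).
by rewrite -!tassocM ract_lact.
Qed.

End Associator.
End MultiplierTensor.

Notation "m *M n" := (mtens m n) : ring_scope.

Section MultiplierScale.
Variables (K : fieldType) (B : nonUnitalAlgType K).
Implicit Types m n : multiplier B.

Lemma mult_scaleAl k m n : k *: (m * n) = (k *: m) * n.
Proof.
by apply: multiplierP => x //=; rewrite (linear_funZ (ract_linear n)).
Qed.

Lemma mult_scaleAr k m n : k *: (m * n) = m * (k *: n).
Proof.
by apply: multiplierP => x //=; rewrite (linear_funZ (lact_linear m)).
Qed.

End MultiplierScale.

Lemma mtens11 (K : fieldType) (A B : nonUnitalAlgType K) :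
  1 *M 1 = 1 :> multiplier (tensor A B).
Proof.
apply: multiplierP.
  apply: tensor_ext => [||u v]; try exact: lact_linear.
  by rewrite /= (@tmapE K A B A B id id).
apply: tensor_ext => [||u v]; try exact: ract_linear.
by rewrite /= (@tmapE K A B A B id id).
Qed.


Definition non_degenerate (K : fieldType) (A : nonUnitalAlgType K) : Prop :=
  (forall a : A, (forall b, a ** b = 0) -> a = 0) /\
  (forall a : A, (forall b, b ** a = 0) -> a = 0).

Section Coproduct.
Variables (K : fieldType) (A : nonUnitalAlgType K).

Local Notation A2 := (tensor A A).
Local Notation A3 := (tensor (tensor A A) A).

Variable Delta : {linear A -> multiplier A2}.

Definition T1 : A2 -> multiplier A2 :=
  tlift (fun a b : A => Delta a * (1 *M inM b)).
Definition T2 : A2 -> multiplier A2 :=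
  tlift (fun c a : A => (inM c *M 1) * Delta a).
Definition T3 : A2 -> multiplier A2 :=
  tlift (fun a b : A => (1 *M inM b) * Delta a).
Definition T4 : A2 -> multiplier A2 :=
  tlift (fun c a : A => Delta a * (inM c *M 1)).

(* Delta (x) iota, and iota (x) Delta with values transported to
   M((A (x) A) (x) A). *)
Definition Delta_id : A2 -> multiplier A3 :=
  tlift (fun a b : A => Delta a *M inM b).
Definition id_Delta : A2 -> multiplier A3 :=
  tlift (fun a b : A => massoc (inM a *M Delta b)).

Definition slice_l (psi : {scalar A}) : A2 -> A :=
  tlift (fun a b : A => psi a *: b).
Definition slice_r (phi : {scalar A}) : A2 -> A :=
  tlift (fun a b : A => phi b *: a).

Definition regular_map (T : A2 -> multiplier A2) : Prop :=
  forall x, exists y, T x = inM y.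

Definition bijective_map (T : A2 -> multiplier A2) : Prop :=
  exists2 f : A2 -> A2, bijective f & forall x, T x = inM (f x).

(* Delta_id and id_Delta are applied to the elements of A (x) A which
   represent the given multipliers; they exist as soon as the two canonical
   maps involved are regular. *)
Definition coassociative12 : Prop :=
  forall (a b c : A) (x y : A2),
    inM x = Delta a * (1 *M inM b) -> inM y = (inM c *M 1) * Delta a ->
    ((inM c *M 1) *M 1) * Delta_id x = id_Delta y * ((1 *M 1) *M inM b).
Definition coassociative34 : Prop :=
  forall (a b c : A) (x y : A2),
    inM x = (1 *M inM b) * Delta a -> inM y = Delta a * (inM c *M 1) ->
    Delta_id x * ((inM c *M 1) *M 1) = ((1 *M 1) *M inM b) * id_Delta y.
Definition coassociative14 : Prop :=
  forall (a b c : A) (x y : A2),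
    inM x = Delta a * (1 *M inM b) -> inM y = Delta a * (inM c *M 1) ->
    Delta_id x * ((inM c *M 1) *M 1) = id_Delta y * ((1 *M 1) *M inM b).
Definition coassociative23 : Prop :=
  forall (a b c : A) (x y : A2),
    inM x = (1 *M inM b) * Delta a -> inM y = (inM c *M 1) * Delta a ->
    ((inM c *M 1) *M 1) * Delta_id x = ((1 *M 1) *M inM b) * id_Delta y.

Definition coproduct : Prop :=
  {morph Delta : a b / a ** b >-> a * b} /\
  [\/ [/\ regular_map T1, regular_map T2 & coassociative12],
      [/\ regular_map T3, regular_map T4 & coassociative34],
      [/\ regular_map T1, regular_map T4 & coassociative14] |
      [/\ regular_map T2, regular_map T3 & coassociative23]].

Definition regular_coproduct : Prop :=
  coproduct /\
  [/\ regular_map T1, regular_map T2, regular_map T3 & regular_map T4].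

Definition left_integral (phi : {scalar A}) : Prop :=
  (exists a, phi a != 0) /\
  forall a c c' : A, exists x : A2,
    inM x = (inM c *M 1) * Delta a * (inM c' *M 1) /\
    slice_r phi x = phi a *: (c ** c').

Definition right_integral (psi : {scalar A}) : Prop :=
  (exists a, psi a != 0) /\
  forall a b b' : A, exists x : A2,
    inM x = (1 *M inM b') * Delta a * (1 *M inM b) /\
    slice_l psi x = psi a *: (b' ** b).

Definition left_faithful (omega : {scalar A}) : Prop :=
  forall a, (forall b, omega (a ** b) = 0) -> a = 0.
Definition right_faithful (omega : {scalar A}) : Prop :=
  forall a, (forall c, omega (c ** a) = 0) -> a = 0.
Definition faithful (omega : {scalar A}) : Prop :=
  left_faithful omega /\ right_faithful omega.

Definition multiplier_Hopf_algebra : Prop :=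
  [/\ non_degenerate A, coproduct, regular_map T1 /\ regular_map T2,
      bijective_map T1 & bijective_map T2].

Definition regular_multiplier_Hopf_algebra : Prop :=
  [/\ multiplier_Hopf_algebra, regular_map T3 /\ regular_map T4,
      bijective_map T3 & bijective_map T4].


Lemma T1_bilinear : bilinear_map (fun a b : A => Delta a * (1 *M inM b)).
Proof.
split=> [b k a a'|a k b b'] /=.
  by rewrite linearP mulrDl -mult_scaleAl.
by rewrite inM_linear (mtens_bilinear _ _).2 mulrDr -mult_scaleAr.
Qed.

Lemma T2_bilinear : bilinear_map (fun c a : A => (inM c *M 1) * Delta a).
Proof.
split=> [a k c c'|c k a a'] /=.
  by rewrite inM_linear (mtens_bilinear _ _).1 mulrDl -mult_scaleAl.
by rewrite linearP mulrDr -mult_scaleAr.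
Qed.

Lemma T3_bilinear : bilinear_map (fun a b : A => (1 *M inM b) * Delta a).
Proof.
split=> [b k a a'|a k b b'] /=.
  by rewrite linearP mulrDr -mult_scaleAr.
by rewrite inM_linear (mtens_bilinear _ _).2 mulrDl -mult_scaleAl.
Qed.

Lemma T4_bilinear : bilinear_map (fun c a : A => Delta a * (inM c *M 1)).
Proof.
split=> [a k c c'|c k a a'] /=.
  by rewrite inM_linear (mtens_bilinear _ _).1 mulrDr -mult_scaleAr.
by rewrite linearP mulrDl -mult_scaleAl.
Qed.

Lemma Delta_id_bilinear : bilinear_map (fun a b : A => Delta a *M inM b).
Proof.
split=> [b k a a'|a k b b'] /=; rewrite ?linearP ?inM_linear.
  exact: (mtens_bilinear _ _).1.
exact: (mtens_bilinear _ _).2.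
Qed.

Lemma massoc_linear : linear (@massoc K A A A).
Proof.
by move=> k m n; apply: multiplierP => x /=; rewrite tassoc_linear.
Qed.

Lemma id_Delta_bilinear :
  bilinear_map (fun a b : A => massoc (inM a *M Delta b)).
Proof.
split=> [b k a a'|a k b b'] /=; rewrite ?linearP ?inM_linear -massoc_linear.
  by congr massoc; exact: (mtens_bilinear _ _).1.
by congr massoc; exact: (mtens_bilinear _ _).2.
Qed.

Lemma slice_l_bilinear (psi : {scalar A}) :
  bilinear_map (fun a b : A => psi a *: b).
Proof.
split=> [b k a a'|a k b b'] /=; first by rewrite linearP scalerDl scalerA.
by rewrite scalerDr !scalerA mulrC.
Qed.

Lemma slice_r_bilinear (phi : {scalar A}) :
  bilinear_map (fun a b : A => phi b *: a).
Proof.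
split=> [b k a a'|a k b b'] /=; last by rewrite linearP scalerDl scalerA.
by rewrite scalerDr !scalerA mulrC.
Qed.

End Coproduct.

(* Main.v *)
(* Larson-Sweedler argument.  If T1 z = 0, then T1 (c z) = Delta(c) T1 z = 0, and
   applying psi (x) iota gives (psi(c .) (x) iota) z = 0 for all c, so z = 0.
   For the range, left invariance of phi gives
     T1 (sum_j x_j (x) y_j) = x (x) y,  x = (iota (x) phi)(Delta(p)(1 (x) q)),
   where Delta(q)(y (x) 1) = sum_j y_j (x) q_j and
   x_j = (iota (x) phi)(Delta(p)(1 (x) q_j)); formally, sum_j x_j (x) y_j is
   (iota (x) S)(Delta(x)) (1 (x) y).  Let V be the span of such x.  Faithfulness of
   phi puts the range of T1 in V (x) A, while V (x) A is contained in
   T1 (V (x) A).  Injectivity then forces V (x) A = A (x) A and T1 is onto.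
   The other three canonical maps follow by passing to the opposite product, the
   opposite coproduct, or both. *)
Require Import Defs.
From mathcomp Require Import all_boot all_algebra.
From mathcomp Require Import boolp reals.
From mathcomp.real_closed Require Import complex.
Set Implicit Arguments.
Unset Strict Implicit.
Unset Printing Implicit Defensive.
Import GRing.Theory.
Local Open Scope ring_scope.

(** * Elementary facts on linear maps *)

Lemma linear_fun_sum (K : fieldType) (U V : lmodType K) (f : U -> V) (I : Type)
    (s : seq I) (F : I -> U) :
  linear f -> f (\sum_(i <- s) F i) = \sum_(i <- s) f (F i).
Proof.
move=> hf; elim: s => [|i s ih]; first by rewrite !big_nil (linear_fun0 hf).
by rewrite !big_cons (linear_funD hf) ih.
Qed.

Lemma linear_funB (K : fieldType) (U V : lmodType K) (f : U -> V) x y :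
  linear f -> f (x - y) = f x - f y.
Proof.
by move=> hf; rewrite -scaleN1r (linear_funD hf) (linear_funZ hf) scaleN1r.
Qed.

Lemma linear_id (K : fieldType) (U : lmodType K) : linear (@id U).
Proof. by []. Qed.

(** * Slices of tensors, and tensors with left factors in a subspace *)

Section TensorSpan.
Variables (K : fieldType) (U V : lmodType K).

Lemma word_sum (s : seq (U * V)) : word s = \sum_(p <- s) p.1 *t p.2.
Proof.
elim: s => [|[u v] s ih]; first by rewrite big_nil.
by rewrite -cat1s word_cat ih big_cons.
Qed.

(** For a functional on [A] this is convertible to [slice_r]. A bare function [f] is taken because
    functionals such as [fun b => phi (mul b r)] arise with a separate proof of linearity. *)
Definition rslice (f : V -> K) : tensor U V -> U := tlift (fun u v => f v *: u).
Definition lslice (f : U -> K) : tensor U V -> V := tlift (fun u v => f u *: v).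
Definition tflip : tensor U V -> tensor V U := tlift (fun u v => v *t u).

Lemma rslice_bilinear (f : V -> K) :
  scalar f -> bilinear_map (fun (u : U) (v : V) => f v *: u).
Proof.
move=> hf; split=> [v k u u'|u k v v'] /=; last by rewrite hf scalerDl scalerA.
by rewrite scalerDr !scalerA mulrC.
Qed.

Lemma lslice_bilinear (f : U -> K) :
  scalar f -> bilinear_map (fun (u : U) (v : V) => f u *: v).
Proof.
move=> hf; split=> [v k u u'|u k v v'] /=; first by rewrite hf scalerDl scalerA.
by rewrite scalerDr !scalerA mulrC.
Qed.

Lemma rslice_linear (f : V -> K) : scalar f -> linear (rslice f).
Proof. by move=> hf; exact: tlift_linear (rslice_bilinear hf). Qed.
Lemma rsliceE (f : V -> K) u v : scalar f -> rslice f (u *t v) = f v *: u.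
Proof. by move=> hf; exact: tliftE (rslice_bilinear hf) _ _. Qed.
Lemma lslice_linear (f : U -> K) : scalar f -> linear (lslice f).
Proof. by move=> hf; exact: tlift_linear (lslice_bilinear hf). Qed.
Lemma lsliceE (f : U -> K) u v : scalar f -> lslice f (u *t v) = f u *: v.
Proof. by move=> hf; exact: tliftE (lslice_bilinear hf) _ _. Qed.

Lemma tflip_bilinear : bilinear_map (fun (u : U) (v : V) => v *t u).
Proof. by split=> *; [exact: (tens_bilinear _ _).2 | exact: (tens_bilinear _ _).1]. Qed.
Lemma tflip_linear : linear tflip.
Proof. exact: tlift_linear tflip_bilinear. Qed.
Lemma tflipE u v : tflip (u *t v) = v *t u.
Proof. exact: tliftE tflip_bilinear _ _. Qed.

(** For a subspace [P] this is the image of [P (x) V] in [U (x) V]. The explicit word allows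
    induction on its length. *)
Definition tspan (P : U -> Prop) (z : tensor U V) : Prop :=
  exists2 s, z = word s & forall p, p \in s -> P p.1.

(* If [f v0 != 0], then [u0] is a combination of the slice and of the other
   left factors, which eliminates the word [u0 (x) v0] up to [P (x) V]. *)
Lemma rslice_tspan (P : U -> Prop) (I : Type) (f : I -> V -> K) z :
  P 0 -> (forall k u u', P u -> P u' -> P (k *: u + u')) ->
  (forall i, scalar (f i)) -> (forall v, (forall i, f i v = 0) -> v = 0) ->
  (forall i, P (rslice (f i) z)) -> tspan P z.
Proof.
move=> P0 PD hf sep; elim/wordW: z => s.
elim: {s}(size s) {-2}s (leqnn (size s)) => [|n ih] [|[u0 v0] s] //= hs hP;
  try by exists [::].
have [v00|nv0] := pselect (v0 = 0).
  have e : word ((u0, v0) :: s) = word s.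
    by rewrite -cat1s word_cat v00 [word [:: _]](bilinear0r (tens_bilinear _ _)) add0r.
  by rewrite e in hP *; exact: ih.
have [i fi] : exists i, f i v0 != 0.
  apply: contrapT => h; apply: nv0; apply: sep => i.
  by apply: contrapT => /eqP fi; apply: h; exists i.
(* The projection onto the kernel of [f i] along [v0]. The components along [v0] that it removes are
   collected in [w], so [s'] is one entry shorter than the given word. *)
pose g (v : V) := v - (f i v / f i v0) *: v0.
pose s' := [seq (p.1, g p.2) | p <- s].
pose w := (f i v0)^-1 *: rslice (f i) (word ((u0, v0) :: s)).
have e : word ((u0, v0) :: s) = w *t v0 + word s'.
  have -> : w = u0 + \sum_(p <- s) (f i p.2 / f i v0) *: p.1.
    rewrite /w word_sum (linear_fun_sum _ _ (rslice_linear (hf i))).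
    rewrite big_cons rsliceE // scalerDr scalerA mulVf // scale1r; congr (_ + _).
    rewrite scaler_sumr; apply: eq_bigr => p _.
    by rewrite rsliceE // scalerA mulrC.
  rewrite (bilinearDl (tens_bilinear _ _)) (linear_fun_sum _ _ ((tens_bilinear _ _).1 v0)).
  rewrite word_sum big_cons /= -addrA; congr (_ + _).
  rewrite word_sum big_map -big_split /=; apply: eq_bigr => p _.
  rewrite -[g _]/(p.2 - _) (bilinearDr (tens_bilinear _ _)) (bilinearZl (tens_bilinear _ _)).
  rewrite -scaleN1r !(bilinearZr (tens_bilinear _ _)) scaleN1r.
  by rewrite addrCA addrN addr0.
have Pw : P w by rewrite -[w]addr0; exact: PD.
(* Each slice of [word s'] is a slice of the given tensor minus a multiple of [w], hence still in
   [P]. *)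
have [t et Pt] : tspan P (word s').
  apply: ih => [|j]; first by rewrite size_map.
  have -> : word s' = (-1) *: (w *t v0) + word ((u0, v0) :: s).
    by rewrite e scaleN1r addrA addNr add0r.
  rewrite (rslice_linear (hf j)) rsliceE // scalerA.
  exact: PD.
exists ((w, v0) :: t); first by rewrite e et -cat1s [RHS]word_cat.
by move=> p; rewrite inE => /predU1P[-> //|]; exact: Pt.
Qed.

(** This is [rslice_tspan] for the zero subspace: all left factors of some representing word
    vanish. *)
Lemma rslice_eq0 (I : Type) (f : I -> V -> K) z :
  (forall i, scalar (f i)) -> (forall v, (forall i, f i v = 0) -> v = 0) ->
  (forall i, rslice (f i) z = 0) -> z = 0.
Proof.
move=> hf sep hz.
have [||s -> hs] := @rslice_tspan (fun u => u = 0) I f z _ _ hf sep hz => //.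
  by move=> k u u' -> ->; rewrite scaler0 addr0.
rewrite word_sum big_seq big1 // => p /hs ->.
exact: (bilinear0l (tens_bilinear _ _)).
Qed.

End TensorSpan.

Section TensorSlices.
Variables (K : fieldType).

Lemma tflipK (U V : lmodType K) : cancel (@tflip K U V) (@tflip K V U).
Proof.
apply: (@tensor_ext _ _ _ _ (@tflip _ _ _ \o @tflip _ _ _) id) => [||u v] //=;
  last by rewrite !tflipE.
by apply: linear_comp; exact: tflip_linear.
Qed.

Lemma rslice_flip (U V : lmodType K) (f : U -> K) (z : tensor U V) : scalar f ->
  rslice f (tflip z) = lslice f z.
Proof.
move=> hf; move: z; apply: (@tensor_ext _ _ _ _ (rslice f \o _)) => [||u v] /=.
- by apply: linear_comp; [exact: rslice_linear | exact: tflip_linear].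
- exact: lslice_linear.
- by rewrite tflipE rsliceE // lsliceE.
Qed.

Lemma lslice_eq0 (U V : lmodType K) (I : Type) (f : I -> U -> K) (z : tensor U V) :
  (forall i, scalar (f i)) -> (forall v, (forall i, f i v = 0) -> v = 0) ->
  (forall i, lslice (f i) z = 0) -> z = 0.
Proof.
move=> hf sep hz; rewrite -[z]tflipK (_ : tflip z = 0).
  exact: (linear_fun0 (@tflip_linear _ _ _)).
by apply: (rslice_eq0 hf sep) => i; rewrite rslice_flip.
Qed.

Variables (U V U' V' : lmodType K).

Lemma rslice_tmap (g : U -> U') (h : V -> V') (f : V' -> K) z :
  linear g -> linear h -> scalar f ->
  rslice f (tmap g h z) = g (rslice (f \o h) z).
Proof.
move=> hg hh hf.
have hfh : scalar (f \o h) by move=> k x y /=; rewrite hh hf.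
move: z.
apply: (@tensor_ext _ _ _ _ (rslice f \o tmap g h) (g \o rslice (f \o h))) => [||u v] /=.
- by apply: linear_comp; [exact: rslice_linear | exact: tmap_linear].
- by apply: linear_comp => //; exact: rslice_linear.
- by rewrite tmapE // !rsliceE // (linear_funZ hg).
Qed.

Lemma lslice_tmap (g : U -> U') (h : V -> V') (f : U' -> K) z :
  linear g -> linear h -> scalar f ->
  lslice f (tmap g h z) = h (lslice (f \o g) z).
Proof.
move=> hg hh hf.
have hfg : scalar (f \o g) by move=> k x y /=; rewrite hg hf.
move: z.
apply: (@tensor_ext _ _ _ _ (lslice f \o tmap g h) (h \o lslice (f \o g))) => [||u v] /=.
- by apply: linear_comp; [exact: lslice_linear | exact: tmap_linear].
- by apply: linear_comp => //; exact: lslice_linear.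
- by rewrite tmapE // !lsliceE // (linear_funZ hh).
Qed.

Lemma tflip_tmap (g : U -> U') (h : V -> V') z : linear g -> linear h ->
  tflip (tmap g h z) = tmap h g (tflip z).
Proof.
move=> hg hh; move: z.
apply: (@tensor_ext _ _ _ _ (@tflip _ _ _ \o tmap g h) (tmap h g \o @tflip _ _ _)) =>
  [||u v] /=.
- by apply: linear_comp; [exact: tflip_linear | exact: tmap_linear].
- by apply: linear_comp; [exact: tmap_linear | exact: tflip_linear].
- by rewrite tmapE // !tflipE tmapE.
Qed.

Lemma tmap_comp (U'' V'' : lmodType K) (g : U -> U') (h : V -> V')
    (g' : U' -> U'') (h' : V' -> V'') z :
  linear g -> linear h -> linear g' -> linear h' ->
  tmap g' h' (tmap g h z) = tmap (g' \o g) (h' \o h) z.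
Proof.
move=> hg hh hg' hh'.
have hgg : linear (g' \o g) by exact: linear_comp.
have hhh : linear (h' \o h) by exact: linear_comp.
move: z; apply: (@tensor_ext _ _ _ _ (tmap g' h' \o tmap g h)) => [||u v] /=.
- by apply: linear_comp; exact: tmap_linear.
- exact: tmap_linear.
- by rewrite !tmapE.
Qed.

End TensorSlices.

(** Taking separation as a hypothesis avoids choosing a basis. In the application it comes from the
    functionals [a |-> phi (a b)] with [phi] left faithful. *)
Definition dual_separates (K : fieldType) (V : lmodType K) : Prop :=
  forall v : V, (forall f : V -> K, scalar f -> f v = 0) -> v = 0.

(** * Jointly injective families remain so after tensoring with an identity map *)

Section JointInjectivity.
Variables (K : fieldType) (U V U' V' : lmodType K).

(** Slicing the second leg by a functional commutes with [g j] on the first leg. So every slice of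
    [z] is killed by all [g j], hence zero, and [z] is zero because functionals separate [V]. *)
Lemma tmap_left_joint_inj (J : Type) (g : J -> U -> U') (z : tensor U V) :
  dual_separates V ->
  (forall j, linear (g j)) -> (forall u, (forall j, g j u = 0) -> u = 0) ->
  (forall j, tmap (g j) id z = 0 :> tensor U' V) -> z = 0.
Proof.
move=> sep hg gI hz.
apply: (@rslice_eq0 _ _ _ {f : V -> K | scalar f} (fun f => sval f)) =>
  [[]||[f hf] /=] //.
  by move=> v hv; apply: sep => f hf; exact: hv (exist _ f hf).
apply: gI => j; rewrite -[RHS](linear_fun0 (rslice_linear hf)) -(hz j).
by rewrite rslice_tmap.
Qed.

Lemma tmap_right_joint_inj (J : Type) (g : J -> V -> V') (z : tensor U V) :
  dual_separates U ->
  (forall j, linear (g j)) -> (forall u, (forall j, g j u = 0) -> u = 0) ->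
  (forall j, tmap id (g j) z = 0 :> tensor U V') -> z = 0.
Proof.
move=> sep hg gI hz.
apply: (@lslice_eq0 _ _ _ {f : U -> K | scalar f} (fun f => sval f)) =>
  [[]||[f hf] /=] //.
  by move=> v hv; apply: sep => f hf; exact: hv (exist _ f hf).
apply: gI => j; rewrite -[RHS](linear_fun0 (lslice_linear hf)) -(hz j).
by rewrite lslice_tmap.
Qed.

(** The product functionals [g (x) f], written [g \o rslice f], already separate the tensors. *)
Lemma dual_separates_tensor :
  dual_separates U -> dual_separates V -> dual_separates (tensor U V).
Proof.
move=> sU sV z hz.
apply: (@rslice_eq0 _ _ _ {f : V -> K | scalar f} (fun f => sval f)) =>
  [[]||[f hf] /=] //.
  by move=> v hv; apply: sV => f hf; exact: hv (exist _ f hf).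
apply: sU => g hg; apply: (hz (g \o rslice f)) => k x y /=.
by rewrite (rslice_linear hf) hg.
Qed.

(** This supplies the bilinearity that gives meaning to the [tlift] in formulas for
    [Delta p * z]. *)
Lemma tmap_mul_left_bilinear (W : lmodType K) (m : V' -> U -> U')
    (g : W -> tensor U V) :
  bilinear_map m -> linear g ->
  bilinear_map (fun u v => tmap (m u) id (g v) : tensor U' V).
Proof.
move=> hm hg; split=> [v k u u'|u k v v'] /=.
  elim/tensor_ind: (g v) => [a b|a b].
    by rewrite !tmapE ?(hm.1 a k u u') ?(tens_bilinear _ _).1 //; exact: hm.2.
  rewrite !(linear_funD (tmap_linear (hm.2 _) (@linear_id _ _))).
  by move=> -> ->; rewrite scalerDr addrACA.
by rewrite hg (tmap_linear (hm.2 u) (@linear_id _ _)).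
Qed.

Lemma tmap_mul_right_bilinear (W : lmodType K) (m : U' -> V -> V')
    (g : W -> tensor U V) :
  bilinear_map m -> linear g ->
  bilinear_map (fun v u => tmap id (m u) (g v) : tensor U V').
Proof.
move=> hm hg; split=> [u k v v'|v k u u'] /=.
  by rewrite hg (tmap_linear (@linear_id _ _) (hm.2 u)).
elim/tensor_ind: (g v) => [a b|a b].
  by rewrite !tmapE ?(hm.1 b k u u') ?(tens_bilinear _ _).2 //; exact: hm.2.
rewrite !(linear_funD (tmap_linear (@linear_id _ _) (hm.2 _))).
by move=> -> ->; rewrite scalerDr addrACA.
Qed.

End JointInjectivity.

Lemma bilinear_swap (K : fieldType) (U V W : lmodType K) (f : U -> V -> W) :
  bilinear_map f -> bilinear_map (fun v u => f u v).
Proof. by case. Qed.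

(** * Bijectivity of one canonical map, axiomatised so that an opposite product can be substituted
    for [mul] *)

Section CanonicalMap.
Variables (K : fieldType) (A : lmodType K) (mul : A -> A -> A).
Variables (T1 T2 T4 : tensor A A -> tensor A A) (phi psi : A -> K).
Hypotheses (mul_bil : bilinear_map mul).
Hypotheses (T1_lin : linear T1) (T2_lin : linear T2).
Hypotheses (phi_lin : scalar phi) (psi_lin : scalar psi).
Hypothesis mulI : forall a, (forall c, mul c a = 0) -> a = 0.
Hypothesis phi_faithful : forall a, (forall b, phi (mul a b) = 0) -> a = 0.
Hypothesis psi_faithful : forall a, (forall c, psi (mul c a) = 0) -> a = 0.
Hypothesis T1_ker : forall c z, T1 z = 0 -> T1 (tmap (mul c) id z) = 0.
(** Right invariance of [psi] and left invariance of [phi], each with a covering factor on one side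
    only. *)
Hypothesis psi_T1 : forall a b, lslice psi (T1 (a *t b)) = psi a *: b.
Hypothesis phi_T4 : forall c a, rslice phi (T4 (c *t a)) = phi a *: c.
(** Both sides stand for [(c (x) 1) Delta(p) (1 (x) q)]. *)
Hypothesis T2_mulr : forall c p q,
  tmap id (mul^~ q) (T2 (c *t p)) = tmap (mul c) id (T1 (p *t q)).
Hypothesis T1_mulr : forall p q r,
  T1 (p *t mul q r) = tmap id (mul^~ r) (T1 (p *t q)).
(* [Delta p * (Delta q * (y (x) 1)) = Delta (p q) * (y (x) 1)] *)
Hypothesis T4_mul : forall p y q,
  tlift (fun u v => tmap (mul^~ u) id (T1 (p *t v))) (T4 (y *t q)) =
  T4 (y *t mul p q).
(** Coassociativity with [phi] applied to the third leg. *)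
Hypothesis coassoc : forall c p b,
  T2 (c *t rslice phi (T1 (p *t b))) =
  tmap id (fun p' => rslice phi (T1 (p' *t b))) (T2 (c *t p)).

Let tensDl := bilinearDl (@tens_bilinear K A A).
Let phi_mul_lin r : scalar (fun b => phi (mul b r)).
Proof. by move=> k x y; rewrite (mul_bil.1 r) phi_lin. Qed.
Let psi_mul_lin c : scalar (fun a => psi (mul c a)).
Proof. by move=> k x y; rewrite (mul_bil.2 c) psi_lin. Qed.

Lemma canonical_map_ker z : T1 z = 0 -> z = 0.
Proof.
move=> z0; apply: (lslice_eq0 psi_mul_lin psi_faithful) => c.
(* By right invariance, [psi (x) iota] sends [T1 (c u (x) v)] to [psi (c u) v]. *)
have -> : lslice (fun a => psi (mul c a)) z = lslice psi (T1 (tmap (mul c) id z)).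
  move: z {z0}; apply: (@tensor_ext _ _ _ _ _ (lslice psi \o (T1 \o tmap (mul c) id))).
  - exact: lslice_linear.
  - apply: linear_comp; first exact: lslice_linear.
    by apply: linear_comp => //; apply: tmap_linear => //; exact: mul_bil.2.
  - by move=> u v /=; rewrite lsliceE // tmapE ?psi_T1 //; exact: mul_bil.2.
by rewrite T1_ker // (linear_fun0 (lslice_linear psi_lin)).
Qed.

Lemma canonical_map_inj : injective T1.
Proof.
move=> x y e; apply/eqP; rewrite -subr_eq0; apply/eqP; apply: canonical_map_ker.
by rewrite linear_funB // e subrr.
Qed.

(* The leg of [Delta] spanned by the slices [(iota (x) phi)(Delta p (1 (x) q))]. *)
Definition left_leg (v : A) : Prop :=
  exists s : seq (A * A), v = \sum_(x <- s) rslice phi (T1 (x.1 *t x.2)).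

Lemma left_leg0 : left_leg 0.
Proof. by exists [::]; rewrite big_nil. Qed.

Lemma left_leg_lin k u u' : left_leg u -> left_leg u' -> left_leg (k *: u + u').
Proof.
move=> [s ->] [t ->]; exists ([seq (k *: x.1, x.2) | x <- s] ++ t).
rewrite big_cat big_map scaler_sumr /=; congr (_ + _); apply: eq_bigr => x _.
by rewrite (bilinearZl (tens_bilinear _ _)) (linear_funZ T1_lin)
  (linear_funZ (rslice_linear phi_lin)).
Qed.

(** By [T1_mulr], slicing [T1 (p (x) q)] with [phi (. r)] amounts to slicing [T1 (p (x) q r)] with
    [phi], which lands in the leg. Faithfulness makes the functionals [phi (. r)] separating, so
    [rslice_tspan] applies. *)
Lemma canonical_map_range z : tspan left_leg (T1 z).
Proof.
apply: (rslice_tspan left_leg0 left_leg_lin phi_mul_lin phi_faithful) => r.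
elim/tensor_ind: z => [p q|x y hx hy].
  exists [:: (p, mul q r)]; rewrite big_seq1 /= T1_mulr.
  by rewrite rslice_tmap //; exact: mul_bil.1.
rewrite (linear_funD T1_lin) (linear_funD (rslice_linear (phi_mul_lin r))).
by rewrite -[X in X + _]scale1r; exact: left_leg_lin.
Qed.

(** The two tensors are compared after multiplying the first leg by an arbitrary [c]. Both then
    equal [(iota (x) h)((c (x) 1) Delta(p))] with [h p' = phi (p' q) y]. *)
Lemma canonical_map_preimage p q y : exists2 u, tspan left_leg u &
  T1 u = rslice phi (T1 (p *t q)) *t y.
Proof.
(* An entry [x] of [s] is a pair of some [y_j] and [q_j], in this order. *)
have [s es] : exists s, T4 (y *t q) = word s.
  by elim/wordW: (T4 (y *t q)) => s; exists s.
exists (word [seq (rslice phi (T1 (p *t x.2)), x.1) | x <- s]).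
  eexists; first by []; move=> _ /mapP[x _ ->] /=.
  by exists [:: (p, x.2)]; rewrite big_seq1.
apply/eqP; rewrite -subr_eq0; apply/eqP.
have sep : dual_separates A.
  by move=> a ha; apply: phi_faithful => r; exact: ha (phi_mul_lin r).
apply: (tmap_left_joint_inj sep mul_bil.2 mulI) => c.
have mulc := tmap_linear (mul_bil.2 c) (@linear_id K A).
have tm (h : A -> A) := @tmap_linear K A A A A id h (@linear_id K A).
rewrite linear_funB // tmapE ?linear_id //; last exact: mul_bil.2.
have slT b : linear (fun p' => rslice phi (T1 (p' *t b))).
  move=> k u u'.
  by rewrite (tens_bilinear _ _).1 T1_lin (rslice_linear phi_lin).
pose h p' := phi (mul p' q) *: y.
have h_lin : linear h.
  by move=> k u u'; rewrite /h (mul_bil.1 q) phi_lin scalerDl scalerA.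
(* The slice [(iota (x) phi)(Delta(p' q)(y (x) 1))] computed twice: by invariance of [phi], and by
   [T4_mul] from the expansion of [Delta(q)(y (x) 1)]. *)
have hE p' : h p' = \sum_(x <- s) mul (rslice phi (T1 (p' *t x.2))) x.1.
  rewrite /h -phi_T4 -T4_mul es tlift_word.
    rewrite (linear_fun_sum _ _ (rslice_linear phi_lin)).
    by apply: eq_bigr => x _; rewrite rslice_tmap //; exact: mul_bil.1.
  apply: (tmap_mul_left_bilinear (bilinear_swap mul_bil)).
  by move=> k v v'; rewrite (tens_bilinear _ _).2 T1_lin.
(* [T2_mulr] exchanges [T1] for [T2], and coassociativity moves the slice to the second leg of
   [T2 (c (x) p)]. Summing over [s] there gives [h] by [hE]. *)
have -> : tmap (mul c) id (T1 (word [seq (rslice phi (T1 (p *t x.2)), x.1) | x <- s]))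
    = tmap id h (T2 (c *t p)).
  rewrite word_sum big_map (linear_fun_sum _ _ T1_lin) (linear_fun_sum _ _ mulc).
  under eq_bigr => x _.
    rewrite -T2_mulr coassoc tmap_comp //; last exact: mul_bil.1.
    over.
  elim/tensor_ind: (T2 _) => [a b|a b ha hb]; last first.
    rewrite (linear_funD (tm _ h_lin)) -ha -hb -big_split /=.
    apply: eq_bigr => x _; rewrite (linear_funD (tm _ _)) //.
    by apply: linear_comp; [exact: mul_bil.1|].
  rewrite tmapE // hE (linear_fun_sum _ _ ((tens_bilinear _ _).2 a)).
  apply: eq_bigr => x _; rewrite tmapE //.
  by apply: linear_comp; [exact: mul_bil.1|].
(* Again by [T2_mulr], the first factor is the slice of [T2 (c (x) p)] by [phi (. q)]. *)
have -> : mul c (rslice phi (T1 (p *t q))) *t y = tmap id h (T2 (c *t p)).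
  rewrite -[phi]/(phi \o id) -rslice_tmap //; last exact: mul_bil.2.
  rewrite -T2_mulr rslice_tmap //; last exact: mul_bil.1.
  elim/tensor_ind: (T2 _) => [a b|a b ha hb].
    rewrite tmapE // rsliceE; last exact: phi_mul_lin.
    by rewrite (bilinearZl (tens_bilinear _ _)) (bilinearZr (tens_bilinear _ _)).
  rewrite (linear_funD (tm _ h_lin)) -ha -hb (linear_funD (rslice_linear (phi_mul_lin q))).
  by rewrite tensDl.
by rewrite subrr.
Qed.

Lemma tspan_left_leg_preimage z : tspan left_leg z ->
  exists2 u, tspan left_leg u & T1 u = z.
Proof.
case=> s -> {z}; elim: s => [|[v y] s ih] hs.
  exists 0; last exact: linear_fun0.
  by exists [::].
have [u [us -> hus] eu] : exists2 u, tspan left_leg u & T1 u = word s.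
  by apply: ih => p ps; apply: hs; rewrite inE ps orbT.
have [w [ws -> hws] ew] : exists2 w, tspan left_leg w & T1 w = v *t y.
  have [t /= ->] := hs (v, y) (mem_head _ _).
  elim: t => [|[p q] t [w [ws -> hws] ew]].
    exists 0; first by exists [::].
    by rewrite big_nil (bilinear0l (tens_bilinear _ _)); exact: linear_fun0.
  have [w' [ws' -> hws'] ew'] := canonical_map_preimage p q y.
  exists (word (ws' ++ ws)).
    by exists (ws' ++ ws) => // x; rewrite mem_cat => /orP[/hws'|/hws].
  by rewrite word_cat (linear_funD T1_lin) ew ew' big_cons tensDl.
exists (word (ws ++ us)).
  by exists (ws ++ us) => // x; rewrite mem_cat => /orP[/hws|/hus].
by rewrite word_cat (linear_funD T1_lin) eu ew -[in RHS]cat1s word_cat.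
Qed.

Lemma canonical_map_bij : bijective T1.
Proof.
(* By injectivity [z] is the preimage of [T1 z] found in [left_leg (x) A]. *)
have T1_surj z : exists u, T1 u = z.
  have [u hu /canonical_map_inj e] := tspan_left_leg_preimage (canonical_map_range z).
  by rewrite e in hu; have [w _ <-] := tspan_left_leg_preimage hu; exists w.
have [g gK] := choice T1_surj.
by exists g => // z; apply: canonical_map_inj; rewrite gK.
Qed.

End CanonicalMap.

(* Exchanging the tensor factors turns these hypotheses into those of
   [canonical_map_bij]. *)
Section FlippedCanonicalMap.
Variables (K : fieldType) (A : lmodType K) (mul : A -> A -> A).
Variables (T1 T2 T4 : tensor A A -> tensor A A) (phi psi : A -> K).
Hypotheses (mul_bil : bilinear_map mul).
Hypotheses (T1_lin : linear T1) (T2_lin : linear T2).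
Hypotheses (phi_lin : scalar phi) (psi_lin : scalar psi).
Hypothesis mulI : forall a, (forall c, mul c a = 0) -> a = 0.
Hypothesis phi_faithful : forall a, (forall b, phi (mul a b) = 0) -> a = 0.
Hypothesis psi_faithful : forall a, (forall c, psi (mul c a) = 0) -> a = 0.
Hypothesis T1_ker : forall c z, T1 z = 0 -> T1 (tmap id (mul c) z) = 0.
Hypothesis psi_T1 : forall a b, rslice psi (T1 (b *t a)) = psi a *: b.
Hypothesis phi_T4 : forall c a, lslice phi (T4 (a *t c)) = phi a *: c.
Hypothesis T2_mulr : forall c p q,
  tmap (mul^~ q) id (T2 (p *t c)) = tmap id (mul c) (T1 (q *t p)).
Hypothesis T1_mulr : forall p q r,
  T1 (mul q r *t p) = tmap (mul^~ r) id (T1 (q *t p)).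
Hypothesis T4_mul : forall p y q,
  tlift (fun v u => tmap id (mul^~ u) (T1 (v *t p))) (T4 (q *t y)) =
  T4 (mul p q *t y).
Hypothesis coassoc : forall c p b,
  T2 (lslice phi (T1 (b *t p)) *t c) =
  tmap (fun p' => lslice phi (T1 (b *t p'))) id (T2 (p *t c)).

Local Notation conj T := (@tflip K A A \o (T \o @tflip K A A)).

Lemma flipped_canonical_map_bij : bijective T1.
Proof.
have conjE (T : tensor A A -> tensor A A) a b : conj T (a *t b) = tflip (T (b *t a)).
  by rewrite /= tflipE.
have conj_lin (T : tensor A A -> tensor A A) : linear T -> linear (conj T).
  move=> hT; apply: linear_comp; first exact: tflip_linear.
  by apply: linear_comp => //; exact: tflip_linear.
have tflip_bij : bijective (@tflip K A A).
  by exists (@tflip K A A); exact: tflipK.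
have lslice_flip f z : scalar f -> lslice f (@tflip K A A z) = rslice f z.
  by move=> hf; rewrite -rslice_flip // tflipK.
suff [g gK Kg] : bijective (conj T1).
  exists (@tflip K A A \o (g \o @tflip K A A)) => z /=.
    by rewrite -{1}[z]tflipK gK tflipK.
  by apply: (can_inj (@tflipK K A A)); rewrite -[LHS]/(conj T1 (g (tflip z))) Kg.
have mulr := mul_bil.1; have mull := mul_bil.2.
apply: (@canonical_map_bij K A mul (conj T1) (conj T2) (conj T4) phi psi) => //;
  try exact: conj_lin.
- move=> c z /= h; rewrite tflip_tmap // T1_ker ?(linear_fun0 (@tflip_linear _ _ _)) //.
  by rewrite -[T1 _]tflipK h (linear_fun0 (@tflip_linear _ _ _)).
- by move=> a b; rewrite conjE lslice_flip.
- by move=> c a; rewrite conjE rslice_flip.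
- by move=> c p q; rewrite !conjE -!tflip_tmap // T2_mulr.
- by move=> p q r; rewrite !conjE T1_mulr tflip_tmap.
- move=> p y q; rewrite !conjE -T4_mul.
  (* With an explicit word the flip passes through the lift term by term. *)
  have [s ->] : exists s, T4 (q *t y) = word s.
    by elim/wordW: (T4 _) => s; exists s.
  have b1 : bilinear_map (fun v u => tmap id (mul^~ u) (T1 (v *t p))).
    apply: (tmap_mul_right_bilinear (bilinear_swap mul_bil)).
    by move=> k v v'; rewrite (tens_bilinear _ _).1 T1_lin.
  have b2 : bilinear_map (fun u v => tmap (mul^~ u) id (conj T1 (p *t v))).
    apply: (tmap_mul_left_bilinear (bilinear_swap mul_bil)).
    move=> k v v'; rewrite (tens_bilinear _ _).2; exact: conj_lin.
  rewrite (tlift_word b1) word_sum !(linear_fun_sum _ _ (@tflip_linear _ _ _)).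
  rewrite (linear_fun_sum _ _ (tlift_linear b2)); apply: eq_bigr => x _.
  by rewrite tflipE (tliftE b2) conjE tflip_tmap.
- move=> c p b; rewrite !conjE rslice_flip // coassoc.
  have hl : linear (fun p' => lslice phi (T1 (b *t p'))).
    by move=> k x y; rewrite (tens_bilinear _ _).2 T1_lin (lslice_linear phi_lin).
  rewrite tflip_tmap //; congr (tmap id _ _); apply: funext => p'.
  by rewrite conjE rslice_flip.
Qed.

End FlippedCanonicalMap.

(** * Multipliers of non-degenerate algebras and of their tensor products *)

Section Multipliers.
Variables (K : fieldType) (B : nonUnitalAlgType K).
Implicit Types (m : multiplier B) (x : B).

Lemma mult_inM m x : m * inM x = inM (lact m x).
Proof. by apply: multiplierP => z /=; rewrite ?lactM ?ract_lact. Qed.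

Lemma inM_mult m x : inM x * m = inM (ract m x).
Proof. by apply: multiplierP => z /=; rewrite ?ractM ?ract_lact. Qed.

Hypothesis hB : non_degenerate B.

Lemma inM_inj : injective (@inM K B).
Proof.
move=> x y e; apply/eqP; rewrite -subr_eq0; apply/eqP; apply: hB.1 => z.
rewrite (linear_funB _ _ ((@nmul_linearl K B) z)).
by have /(congr1 (fun m => lact m z)) /= -> := e; rewrite subrr.
Qed.

(** Since [y (m x) = (y m) x], non-degeneracy lets the right action determine the left one. *)
Lemma ract_eq0 m : (forall x, ract m x = 0) -> m = 0.
Proof.
move=> h; apply: multiplierP => x //=; apply: hB.2 => y.
by rewrite ract_lact h (bilinear0l (@nmul_bilinear K B)).
Qed.

Lemma lact_eq0 m : (forall x, lact m x = 0) -> m = 0.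
Proof.
move=> h; apply: multiplierP => x //=; apply: hB.1 => y.
by rewrite -ract_lact h (bilinear0r (@nmul_bilinear K B)).
Qed.

(** A family is needed because a single [c (x) 1 (x) 1] may have a kernel; only all [c] together can
    be cancelled. *)
Lemma mult_lcancel (J : Type) (e : J -> multiplier B) m :
  (forall x, (forall j, lact (e j) x = 0) -> x = 0) ->
  (forall j, e j * m = 0) -> m = 0.
Proof.
move=> he h; apply: lact_eq0 => x; apply: he => j.
by have /(congr1 (fun m => lact m x)) := h j.
Qed.

Lemma mult_rcancel (J : Type) (e : J -> multiplier B) m :
  (forall x, (forall j, ract (e j) x = 0) -> x = 0) ->
  (forall j, m * e j = 0) -> m = 0.
Proof.
move=> he h; apply: ract_eq0 => x; apply: he => j.
by have /(congr1 (fun m => ract m x)) := h j.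
Qed.

End Multipliers.

Section TensorMultipliers.
Variables (K : fieldType).

Lemma mtens_mul (A B : nonUnitalAlgType K) (m m' : multiplier A)
    (n n' : multiplier B) :
  (m *M n) * (m' *M n') = (m * m') *M (n * n').
Proof.
apply: multiplierP.
  by move=> z; apply: tmap_comp; exact: lact_linear.
by move=> z; apply: tmap_comp; exact: ract_linear.
Qed.

(** Multiplication by [a (x) b] is multiplication by [a] on one leg followed by [b] on the other, so
    joint injectivity is applied once to each leg. *)
Lemma non_degenerate_tensor (A B : nonUnitalAlgType K) :
  dual_separates A -> dual_separates B ->
  non_degenerate A -> non_degenerate B -> non_degenerate (tensor A B).
Proof.
move=> sA sB [A1 A2] [B1 B2].
have ll (C : nonUnitalAlgType K) := @nmul_linearl K C.
have lr (C : nonUnitalAlgType K) := @nmul_linearr K C.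
split=> z hz.
  apply: (@tmap_left_joint_inj _ _ _ _ _ (fun a : A => nmul^~ a) _ sB (@ll A) A1) => a.
  apply: (@tmap_right_joint_inj _ _ _ _ _ (fun b : B => nmul^~ b) _ sA (@ll B) B1) => b.
  rewrite (tmap_comp _ (@ll A a) (@linear_id _ _) (@linear_id _ _) (@ll B b));
    apply: etrans (hz (a *t b)).
  move: z {hz}; apply: tensor_ext => [||u v]; first exact: (tmap_linear (ll A a) (ll B b)).
    exact: nmul_linearl.
  by rewrite (tmapE (ll A a) (ll B b)) tens_mul.
apply: (@tmap_left_joint_inj _ _ _ _ _ (fun a : A => nmul a) _ sB (@lr A) A2) => a.
apply: (@tmap_right_joint_inj _ _ _ _ _ (fun b : B => nmul b) _ sA (@lr B) B2) => b.
rewrite (tmap_comp _ (@lr A a) (@linear_id _ _) (@linear_id _ _) (@lr B b));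
    apply: etrans (hz (a *t b)).
move: z {hz}; apply: tensor_ext => [||u v]; first exact: (tmap_linear (lr A a) (lr B b)).
  exact: nmul_linearr.
by rewrite (tmapE (lr A a) (lr B b)) tens_mul.
Qed.

Lemma massocM (A B C : nonUnitalAlgType K) (m n : multiplier (tensor A (tensor B C))) :
  massoc (m * n) = massoc m * massoc n.
Proof. by apply: multiplierP => x /=; rewrite tassocK. Qed.

Lemma massoc_inM (A B C : nonUnitalAlgType K) (x : tensor A (tensor B C)) :
  massoc (inM x) = inM (tassoc x).
Proof. by apply: multiplierP => z /=; rewrite tassocM tassocVK. Qed.

Lemma massoc_mtens (A B C : nonUnitalAlgType K) (m : multiplier A)
    (n : multiplier B) (p : multiplier C) :
  massoc (m *M (n *M p)) = (m *M n) *M p.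
Proof.
have assoc_ext (W : lmodType K) (f g : tensor (tensor A B) C -> W) :
    linear f -> linear g ->
    (forall a b c, f ((a *t b) *t c) = g ((a *t b) *t c)) -> f =1 g.
  move=> hf hg e; apply: tensor_ext => // z c.
  pose tc := (fun y : tensor A B => y *t c).
  have tcl : linear tc by exact: (tens_bilinear _ _).1.
  apply: (@tensor_ext _ _ _ _ (f \o tc) (g \o tc)); try exact: linear_comp.
  by move=> a b; exact: e.
apply: multiplierP; apply: assoc_ext; try exact: lact_linear; try exact: ract_linear;
  move=> a b c /=.
- by rewrite tassocVE !tmapE ?tassocE //; do ?apply: tmap_linear; exact: lact_linear.
- by rewrite tassocVE !tmapE ?tassocE //; do ?apply: tmap_linear; exact: ract_linear.
Qed.

End TensorMultipliers.

(** * The four forms of coassociativity and their passage to [A (x) A (x) A] *)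

Section Coassociativity.
Variables (K : fieldType) (A : nonUnitalAlgType K).
Variable Delta : {linear A -> multiplier (tensor A A)}.
Hypotheses (hA : non_degenerate A) (sepA : dual_separates A).
Variables t1 t2 t3 t4 : tensor A A -> tensor A A.
Hypothesis t1E : forall x, T1 Delta x = inM (t1 x).
Hypothesis t2E : forall x, T2 Delta x = inM (t2 x).
Hypothesis t3E : forall x, T3 Delta x = inM (t3 x).
Hypothesis t4E : forall x, T4 Delta x = inM (t4 x).

Let nd2 : non_degenerate (tensor A A) := non_degenerate_tensor sepA sepA hA hA.
Let sep2 : dual_separates (tensor A A) := dual_separates_tensor sepA sepA.
Let nd3 : non_degenerate (tensor (tensor A A) A) :=
  non_degenerate_tensor sep2 sepA nd2 hA.
Let mull := @nmul_linearr K A.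
Let mulr := @nmul_linearl K A.
Let id_lin := @linear_id K A.

Lemma t1_tens a b : inM (t1 (a *t b)) = Delta a * (1 *M inM b).
Proof. by rewrite -t1E; exact: tliftE (T1_bilinear Delta) _ _. Qed.
Lemma t2_tens c a : inM (t2 (c *t a)) = (inM c *M 1) * Delta a.
Proof. by rewrite -t2E; exact: tliftE (T2_bilinear Delta) _ _. Qed.
Lemma t3_tens a b : inM (t3 (a *t b)) = (1 *M inM b) * Delta a.
Proof. by rewrite -t3E; exact: tliftE (T3_bilinear Delta) _ _. Qed.
Lemma t4_tens c a : inM (t4 (c *t a)) = Delta a * (inM c *M 1).
Proof. by rewrite -t4E; exact: tliftE (T4_bilinear Delta) _ _. Qed.

Lemma inM_lift_linear (T : tensor A A -> multiplier (tensor A A)) t :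
  linear T -> (forall x, T x = inM (t x)) -> linear t.
Proof. by move=> hT e k x y; apply: (inM_inj nd2); rewrite inM_linear -!e hT. Qed.

Lemma t1_linear : linear t1.
Proof. by apply: inM_lift_linear t1E; exact: tlift_linear (T1_bilinear Delta). Qed.
Lemma t2_linear : linear t2.
Proof. by apply: inM_lift_linear t2E; exact: tlift_linear (T2_bilinear Delta). Qed.
Lemma t3_linear : linear t3.
Proof. by apply: inM_lift_linear t3E; exact: tlift_linear (T3_bilinear Delta). Qed.
Lemma t4_linear : linear t4.
Proof. by apply: inM_lift_linear t4E; exact: tlift_linear (T4_bilinear Delta). Qed.

Lemma inM_left_mull c (z : tensor A A) :
  inM (tmap (nmul c) id z) = (inM c *M 1) * inM z.
Proof. by rewrite mult_inM. Qed.
Lemma inM_left_mulr c (z : tensor A A) :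
  inM (tmap (nmul^~ c) id z) = inM z * (inM c *M 1).
Proof. by rewrite inM_mult. Qed.
Lemma inM_right_mull c (z : tensor A A) :
  inM (tmap id (nmul c) z) = (1 *M inM c) * inM z.
Proof. by rewrite mult_inM. Qed.
Lemma inM_right_mulr c (z : tensor A A) :
  inM (tmap id (nmul^~ c) z) = inM z * (1 *M inM c).
Proof. by rewrite inM_mult. Qed.

(** In this lemma and the next three, both sides are [Delta p] with one factor on its left and one
    on its right, bracketed in two ways. *)
Lemma t2_mulr c p q :
  tmap id (nmul^~ q) (t2 (c *t p)) = tmap (nmul c) id (t1 (p *t q)).
Proof.
apply: (inM_inj nd2).
by rewrite inM_right_mulr inM_left_mull t2_tens t1_tens mulrA.
Qed.

Lemma t4_mull c p q :
  tmap id (nmul q) (t4 (c *t p)) = tmap (nmul^~ c) id (t3 (p *t q)).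
Proof.
apply: (inM_inj nd2).
by rewrite inM_right_mull inM_left_mulr t4_tens t3_tens mulrA.
Qed.

Lemma t1_t3 p b b' :
  tmap id (nmul b') (t1 (p *t b)) = tmap id (nmul^~ b) (t3 (p *t b')).
Proof.
apply: (inM_inj nd2).
by rewrite inM_right_mull inM_right_mulr t1_tens t3_tens mulrA.
Qed.

Lemma t2_t4 c c' p :
  tmap (nmul^~ c') id (t2 (c *t p)) = tmap (nmul c) id (t4 (c' *t p)).
Proof.
apply: (inM_inj nd2).
by rewrite inM_left_mulr inM_left_mull t2_tens t4_tens mulrA.
Qed.

Local Notation e1 c := ((inM c *M 1) *M 1 : multiplier (tensor (tensor A A) A)).
Local Notation e3 b := ((1 *M 1) *M inM b : multiplier (tensor (tensor A A) A)).

Lemma e1_e3 c b : e1 c * e3 b = e3 b * e1 c.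
Proof. by rewrite !mtens_mul !(mulr1, mul1r). Qed.

Let tmul1l b : linear (tmap id (nmul b) : tensor A A -> tensor A A) :=
  tmap_linear id_lin (mull b).
Let tmul1r b : linear (tmap id (nmul^~ b) : tensor A A -> tensor A A) :=
  tmap_linear id_lin (mulr b).
Let tmull1 b : linear (tmap (nmul b) id : tensor A A -> tensor A A) :=
  tmap_linear (mull b) id_lin.
Let tmulr1 b : linear (tmap (nmul^~ b) id : tensor A A -> tensor A A) :=
  tmap_linear (mulr b) id_lin.

Let Did_lin := tlift_linear (Delta_id_bilinear Delta).
Let idD_lin := tlift_linear (id_Delta_bilinear Delta).
Let DidE := tliftE (Delta_id_bilinear Delta).
Let idDE := tliftE (id_Delta_bilinear Delta).

(** [Delta (x) iota] leaves the last leg alone, so a factor there can be moved inside. The next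
    three lemmas are the variants for the other side and for the first leg under
    [iota (x) Delta]. *)
Lemma e3_Delta_id b x : e3 b * Delta_id Delta x = Delta_id Delta (tmap id (nmul b) x).
Proof.
elim/tensor_ind: x => [u v|x y hx hy].
  by rewrite tmapE // /Delta_id !DidE mtens_mul mtens11 mul1r inM_mul.
rewrite (linear_funD (tmul1l b))
  !(linear_funD Did_lin : forall u v, Delta_id _ (_ + _) = _).
by rewrite mulrDr hx hy.
Qed.

Lemma Delta_id_e3 b x : Delta_id Delta x * e3 b = Delta_id Delta (tmap id (nmul^~ b) x).
Proof.
elim/tensor_ind: x => [u v|x y hx hy].
  by rewrite tmapE // /Delta_id !DidE mtens_mul mtens11 mulr1 inM_mul.
rewrite (linear_funD (tmul1r b))
  !(linear_funD Did_lin : forall u v, Delta_id _ (_ + _) = _).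
by rewrite mulrDl hx hy.
Qed.

Lemma e1_id_Delta c x : e1 c * id_Delta Delta x = id_Delta Delta (tmap (nmul c) id x).
Proof.
elim/tensor_ind: x => [u v|x y hx hy].
  rewrite tmapE // /id_Delta !idDE -massoc_mtens -massocM.
  by rewrite mtens_mul mtens11 mul1r inM_mul.
rewrite (linear_funD (tmull1 c))
  !(linear_funD idD_lin : forall u v, id_Delta _ (_ + _) = _).
by rewrite mulrDr hx hy.
Qed.

Lemma id_Delta_e1 c x : id_Delta Delta x * e1 c = id_Delta Delta (tmap (nmul^~ c) id x).
Proof.
elim/tensor_ind: x => [u v|x y hx hy].
  rewrite tmapE // /id_Delta !idDE -massoc_mtens -massocM.
  by rewrite mtens_mul mtens11 mulr1 inM_mul.
rewrite (linear_funD (tmulr1 c))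
  !(linear_funD idD_lin : forall u v, id_Delta _ (_ + _) = _).
by rewrite mulrDl hx hy.
Qed.

(** The first leg sits inside a nested tensor product, hence two applications of joint
    injectivity. *)
Lemma e1_lcancel m : (forall c, e1 c * m = 0) -> m = 0.
Proof.
apply: mult_lcancel => // x hx.
apply: (@tmap_left_joint_inj _ _ _ _ _ (fun c : A => tmap (nmul c) id)) => // u hu.
exact: (@tmap_left_joint_inj _ _ _ _ _ (fun c : A => nmul c) _ sepA mull hA.2).
Qed.

Lemma e1_rcancel m : (forall c, m * e1 c = 0) -> m = 0.
Proof.
apply: mult_rcancel => // x hx.
apply: (@tmap_left_joint_inj _ _ _ _ _ (fun c : A => tmap (nmul^~ c) id)) => // u hu.
exact: (@tmap_left_joint_inj _ _ _ _ _ (fun c : A => nmul^~ c) _ sepA mulr hA.1).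
Qed.

Lemma e3_lcancel m : (forall b, e3 b * m = 0) -> m = 0.
Proof.
apply: mult_lcancel => // x hx; rewrite mtens11 in hx.
exact: (@tmap_right_joint_inj _ _ _ _ _ (fun c : A => nmul c) _ sep2 mull hA.2).
Qed.

Lemma e3_rcancel m : (forall b, m * e3 b = 0) -> m = 0.
Proof.
apply: mult_rcancel => // x hx; rewrite mtens11 in hx.
exact: (@tmap_right_joint_inj _ _ _ _ _ (fun c : A => nmul^~ c) _ sep2 mulr hA.1).
Qed.

(* All four forms of coassociativity are equivalent to
   [(c (x) 1 (x) b') (Delta (x) iota)(Delta p) (c' (x) 1 (x) b) =
    (c (x) 1 (x) b') (iota (x) Delta)(Delta p) (c' (x) 1 (x) b)]. *)
Definition covered_coassociative : Prop := forall c c' b b' p,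
  e1 c * Delta_id Delta (tmap id (nmul b') (t1 (p *t b))) * e1 c' =
  e3 b' * id_Delta Delta (tmap (nmul^~ c') id (t2 (c *t p))) * e3 b.

(** Each form already carries two of the four covering factors; one multiplies by the other two.
    They are moved inside and regrouped around [Delta p] by [t1_t3] and [t2_t4] where needed. *)
Lemma coassociative_covered :
  [\/ coassociative12 Delta, coassociative34 Delta, coassociative14 Delta |
      coassociative23 Delta] -> covered_coassociative.
Proof.
move=> h c c' b b' p; case: h => h.
- rewrite -e3_Delta_id -id_Delta_e1 mulrA e1_e3 -(mulrA (e3 b')).
  rewrite (h p b c _ _ (t1_tens _ _) (t2_tens _ _)).
  by rewrite -!mulrA -e1_e3.
- rewrite t1_t3 t2_t4 -Delta_id_e3 -e1_id_Delta -!mulrA -e1_e3.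
  rewrite [Delta_id _ _ * _]mulrA (h p b' c' _ _ (t3_tens _ _) (t4_tens _ _)).
  by rewrite !mulrA e1_e3.
- rewrite t2_t4 -e3_Delta_id -e1_id_Delta !mulrA e1_e3 -!mulrA.
  by rewrite (h p b c' _ _ (t1_tens _ _) (t4_tens _ _)).
- rewrite t1_t3 -Delta_id_e3 -id_Delta_e1 -!mulrA -e1_e3 !mulrA.
  by rewrite (h p b' c _ _ (t3_tens _ _) (t2_tens _ _)).
Qed.

Hypothesis coassoc : covered_coassociative.

(** Multiplying by [c'] on the right in the first leg and by [b'] on the left in the third gives the
    covered form, and both factors can be cancelled. *)
Lemma coassoc12 c p b :
  e1 c * Delta_id Delta (t1 (p *t b)) = id_Delta Delta (t2 (c *t p)) * e3 b.
Proof.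
apply/eqP; rewrite -subr_eq0; apply/eqP; apply: e1_rcancel => c'.
apply: e3_lcancel => b'; rewrite mulrBl mulrBr.
apply/eqP; rewrite subr_eq0; apply/eqP.
have := coassoc c c' b b' p; rewrite -e3_Delta_id -id_Delta_e1.
by rewrite !mulrA e1_e3 -!mulrA => ->; rewrite e1_e3.
Qed.

Lemma coassoc34 c p b :
  Delta_id Delta (t3 (p *t b)) * e1 c = e3 b * id_Delta Delta (t4 (c *t p)).
Proof.
apply/eqP; rewrite -subr_eq0; apply/eqP; apply: e1_lcancel => c'.
apply: e3_rcancel => b'; rewrite mulrBr mulrBl.
apply/eqP; rewrite subr_eq0; apply/eqP.
have := coassoc c' c b' b p; rewrite t1_t3 t2_t4 -Delta_id_e3 -e1_id_Delta.
by rewrite -!mulrA -e1_e3 !mulrA e1_e3 => ->.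
Qed.

(** For [t2, t1] and for [t4, t3] this is coassociativity read in [A (x) A (x) A] itself rather than
    among its multipliers, so that functionals can be applied to a leg. *)
Definition legs_commute (S T : tensor A A -> tensor A A) : Prop := forall c p b,
  tmap (fun u => S (c *t u)) id (T (p *t b)) =
  tassoc (tmap id (fun v => T (v *t b)) (S (c *t p))).

Lemma t2_t1_commute : legs_commute t2 t1.
Proof.
move=> c p b; apply: (inM_inj nd3).
have l1 : linear (fun v => t1 (v *t b)).
  by move=> k v v'; rewrite (tens_bilinear _ _).1 t1_linear.
have l2 : linear (fun u => t2 (c *t u)).
  by move=> k v v'; rewrite (tens_bilinear _ _).2 t2_linear.
have e x : inM (tmap (fun u => t2 (c *t u)) id x) = e1 c * Delta_id Delta x.
  elim/tensor_ind: x => [u v|x y hx hy].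
    by rewrite tmapE // -mtens_inM t2_tens /Delta_id DidE mtens_mul mul1r.
  rewrite (linear_funD (tmap_linear l2 id_lin)) (linear_funD (@inM_linear _ _)) hx hy.
  by rewrite (linear_funD Did_lin : forall u v, Delta_id _ (_ + _) = _) mulrDr.
have e' x : inM (tassoc (tmap id (fun v => t1 (v *t b)) x)) = id_Delta Delta x * e3 b.
  elim/tensor_ind: x => [u v|x y hx hy].
    rewrite tmapE // -massoc_inM -mtens_inM t1_tens /id_Delta idDE.
    by rewrite -massoc_mtens -massocM mtens_mul mulr1.
  rewrite (linear_funD (tmap_linear id_lin l1)) (linear_funD (@tassoc_linear _ _ _ _)).
  rewrite (linear_funD (@inM_linear _ _)) hx hy.
  by rewrite (linear_funD idD_lin : forall u v, id_Delta _ (_ + _) = _) mulrDl.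
by rewrite e e' coassoc12.
Qed.

Lemma t4_t3_commute : legs_commute t4 t3.
Proof.
move=> c p b; apply: (inM_inj nd3).
have l1 : linear (fun v => t3 (v *t b)).
  by move=> k v v'; rewrite (tens_bilinear _ _).1 t3_linear.
have l2 : linear (fun u => t4 (c *t u)).
  by move=> k v v'; rewrite (tens_bilinear _ _).2 t4_linear.
have e x : inM (tmap (fun u => t4 (c *t u)) id x) = Delta_id Delta x * e1 c.
  elim/tensor_ind: x => [u v|x y hx hy].
    by rewrite tmapE // -mtens_inM t4_tens /Delta_id DidE mtens_mul mulr1.
  rewrite (linear_funD (tmap_linear l2 id_lin)) (linear_funD (@inM_linear _ _)) hx hy.
  by rewrite (linear_funD Did_lin : forall u v, Delta_id _ (_ + _) = _) mulrDl.
have e' x : inM (tassoc (tmap id (fun v => t3 (v *t b)) x)) = e3 b * id_Delta Delta x.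
  elim/tensor_ind: x => [u v|x y hx hy].
    rewrite tmapE // -massoc_inM -mtens_inM t3_tens /id_Delta idDE.
    by rewrite -massoc_mtens -massocM mtens_mul mul1r.
  rewrite (linear_funD (tmap_linear id_lin l1)) (linear_funD (@tassoc_linear _ _ _ _)).
  rewrite (linear_funD (@inM_linear _ _)) hx hy.
  by rewrite (linear_funD idD_lin : forall u v, id_Delta _ (_ + _) = _) mulrDr.
by rewrite e e' coassoc34.
Qed.

End Coassociativity.

(** * Coassociativity with a functional applied to an outer leg *)

Section LegsCommuteSlices.
Variables (K : fieldType) (A : nonUnitalAlgType K).
Variables (S T : tensor A A -> tensor A A) (f : A -> K).
Hypotheses (S_lin : linear S) (T_lin : linear T) (f_lin : scalar f).
Hypothesis ST : legs_commute S T.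

Let id_lin := @linear_id K A.
Let S_lin2 c : linear (fun u => S (c *t u)).
Proof. by move=> k u v; rewrite (tens_bilinear _ _).2 S_lin. Qed.
Let T_lin1 b : linear (fun u => T (u *t b)).
Proof. by move=> k u v; rewrite (tens_bilinear _ _).1 T_lin. Qed.

(** Apply [iota (x) iota (x) f] to the commutation of legs. *)
Lemma legs_commute_rslice c p b :
  S (c *t rslice f (T (p *t b))) =
  tmap id (fun p' => rslice f (T (p' *t b))) (S (c *t p)).
Proof.
have /(congr1 (rslice f)) := ST c p b.
rewrite rslice_tmap // => ->; elim/tensor_ind: (S _) => [u v|x y hx hy].
  rewrite !tmapE //; last exact: linear_comp (rslice_linear f_lin) (T_lin1 b).
  elim/tensor_ind: (T _) => [a d|x y hx hy].
    by rewrite tassocE !rsliceE // (bilinearZr (tens_bilinear _ _)).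
  rewrite (bilinearDr (tens_bilinear _ _)) (linear_funD (@tassoc_linear _ _ _ _)).
  rewrite !(linear_funD (rslice_linear f_lin)) hx hy.
  by rewrite (bilinearDr (tens_bilinear _ _)).
rewrite (linear_funD (tmap_linear id_lin (T_lin1 b))).
rewrite (linear_funD (@tassoc_linear _ _ _ _)) (linear_funD (rslice_linear f_lin)).
rewrite hx hy (linear_funD (tmap_linear id_lin _)) //.
exact: linear_comp (rslice_linear f_lin) (T_lin1 b).
Qed.

(** Apply [f (x) iota (x) iota]; this is the version for the flipped canonical maps. *)
Lemma legs_commute_lslice c p b :
  T (lslice f (S (c *t p)) *t b) =
  tmap (fun p' => lslice f (S (c *t p'))) id (T (p *t b)).
Proof.
have lf := @lslice_linear K A A _ f_lin.
have /(congr1 (tmap (lslice f) id)) := ST c p b.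
rewrite tmap_comp // => ->; elim/tensor_ind: (S _) => [u v|x y hx hy].
  rewrite tmapE // lsliceE // (bilinearZl (tens_bilinear _ _)) (linear_funZ T_lin).
  elim/tensor_ind: (T _) => [a d|x y hx hy].
    by rewrite tassocE tmapE // lsliceE // (bilinearZl (tens_bilinear _ _)).
  rewrite (bilinearDr (tens_bilinear _ _)) (linear_funD (@tassoc_linear _ _ _ _)).
  by rewrite (linear_funD (tmap_linear lf id_lin)) -hx -hy scalerDr.
rewrite (linear_funD lf) (bilinearDl (tens_bilinear _ _)) (linear_funD T_lin) hx hy.
rewrite (linear_funD (tmap_linear id_lin (T_lin1 b))).
by rewrite (linear_funD (@tassoc_linear _ _ _ _)) (linear_funD (tmap_linear lf id_lin)).
Qed.

End LegsCommuteSlices.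

(** * The four canonical maps of a regular coproduct with integrals *)

Section LarsonSweedler.
Variables (K : fieldType) (A : nonUnitalAlgType K).
Variable Delta : {linear A -> multiplier (tensor A A)}.
Hypotheses (hA : non_degenerate A) (sepA : dual_separates A).
Hypothesis DeltaM : {morph Delta : a b / a ** b >-> a * b}.
Variables t1 t2 t3 t4 : tensor A A -> tensor A A.
Hypothesis t1E : forall x, T1 Delta x = inM (t1 x).
Hypothesis t2E : forall x, T2 Delta x = inM (t2 x).
Hypothesis t3E : forall x, T3 Delta x = inM (t3 x).
Hypothesis t4E : forall x, T4 Delta x = inM (t4 x).
Hypothesis coassoc : covered_coassociative Delta t1 t2.

Let nd2 : non_degenerate (tensor A A) := non_degenerate_tensor sepA sepA hA hA.
Let inj2 := inM_inj nd2.
Let mull := @nmul_linearr K A.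
Let mulr := @nmul_linearl K A.
Let id_lin := @linear_id K A.
Let tensl (b : A) : linear (fun a : A => a *t b) := (@tens_bilinear K A A).1 b.
Let tensr (a : A) : linear (fun b : A => a *t b) := (@tens_bilinear K A A).2 a.
Let t1_lin := t1_linear hA sepA t1E.
Let t2_lin := t2_linear hA sepA t2E.
Let t3_lin := t3_linear hA sepA t3E.
Let t4_lin := t4_linear hA sepA t4E.
Let t1T := t1_tens t1E.
Let t2T := t2_tens t2E.
Let t3T := t3_tens t3E.
Let t4T := t4_tens t4E.
Let op_bil : bilinear_map (fun a b : A => b ** a) :=
  bilinear_swap (@nmul_bilinear K A).

Lemma inM_tens (a b : A) : inM (a *t b) = (inM a *M 1) * (1 *M inM b).
Proof. by rewrite -mtens_inM mtens_mul mulr1 mul1r. Qed.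

Lemma inM_tensC (a b : A) : inM (a *t b) = (1 *M inM b) * (inM a *M 1).
Proof. by rewrite -mtens_inM mtens_mul mulr1 mul1r. Qed.

(** As [Delta] is multiplicative, the kernel of [t1] is stable under left multiplication in the
    first leg. The next three lemmas serve the same purpose for [t4], [t3] and [t2]. *)
Lemma t1_mull c z : inM (t1 (tmap (nmul c) id z)) = Delta c * inM (t1 z).
Proof.
elim/tensor_ind: z => [a b|x y hx hy]; first by rewrite tmapE // !t1T DeltaM mulrA.
rewrite (linear_funD (tmap_linear (mull c) id_lin)) !(linear_funD t1_lin).
by rewrite !(linear_funD (@inM_linear _ _)) hx hy mulrDr.
Qed.

Lemma t4_mull_right c z : inM (t4 (tmap id (nmul c) z)) = Delta c * inM (t4 z).
Proof.
elim/tensor_ind: z => [a b|x y hx hy]; first by rewrite tmapE // !t4T DeltaM mulrA.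
rewrite (linear_funD (tmap_linear id_lin (mull c))) !(linear_funD t4_lin).
by rewrite !(linear_funD (@inM_linear _ _)) hx hy mulrDr.
Qed.

Lemma t3_mulr c z : inM (t3 (tmap (nmul^~ c) id z)) = inM (t3 z) * Delta c.
Proof.
elim/tensor_ind: z => [a b|x y hx hy]; first by rewrite tmapE // !t3T DeltaM mulrA.
rewrite (linear_funD (tmap_linear (mulr c) id_lin)) !(linear_funD t3_lin).
by rewrite !(linear_funD (@inM_linear _ _)) hx hy mulrDl.
Qed.

Lemma t2_mulr_right c z : inM (t2 (tmap id (nmul^~ c) z)) = inM (t2 z) * Delta c.
Proof.
elim/tensor_ind: z => [a b|x y hx hy]; first by rewrite tmapE // !t2T DeltaM mulrA.
rewrite (linear_funD (tmap_linear id_lin (mulr c))) !(linear_funD t2_lin).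
by rewrite !(linear_funD (@inM_linear _ _)) hx hy mulrDl.
Qed.

Lemma t1_ract p q r : t1 (p *t (q ** r)) = tmap id (nmul^~ r) (t1 (p *t q)).
Proof.
by apply: inj2; rewrite inM_right_mulr !t1T inM_mul -mulrA mtens_mul mulr1.
Qed.

Lemma t3_lact p q r : t3 (p *t (r ** q)) = tmap id (nmul r) (t3 (p *t q)).
Proof.
by apply: inj2; rewrite inM_right_mull !t3T inM_mul mulrA mtens_mul mulr1.
Qed.

Lemma t4_ract p q r : t4 ((q ** r) *t p) = tmap (nmul^~ r) id (t4 (q *t p)).
Proof.
by apply: inj2; rewrite inM_left_mulr !t4T inM_mul -mulrA mtens_mul mulr1.
Qed.

Lemma t2_lact p q r : t2 ((r ** q) *t p) = tmap (nmul r) id (t2 (q *t p)).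
Proof.
by apply: inj2; rewrite inM_left_mull !t2T inM_mul mulrA mtens_mul mulr1.
Qed.

(** From [Delta(p)(u (x) v) = Delta(p)(1 (x) v)(u (x) 1)]. With [z = t4 (y (x) q)] this yields
    [Delta(p) Delta(q) (y (x) 1)], as required by [canonical_map_bij]. *)
Lemma t1_lift p z :
  inM (tlift (fun u v => tmap (nmul^~ u) id (t1 (p *t v))) z) = Delta p * inM z.
Proof.
have b : bilinear_map (fun u v => tmap (nmul^~ u) id (t1 (p *t v))).
  exact: tmap_mul_left_bilinear op_bil (linear_comp t1_lin (tensr p)).
elim/tensor_ind: z => [u v|x y hx hy].
  by rewrite tliftE // inM_left_mulr t1T -mulrA -inM_tensC.
by rewrite (linear_funD (tlift_linear b)) !(linear_funD (@inM_linear _ _)) hx hy mulrDr.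
Qed.

Lemma t3_lift p z :
  inM (tlift (fun u v => tmap (nmul u) id (t3 (p *t v))) z) = inM z * Delta p.
Proof.
have b : bilinear_map (fun u v => tmap (nmul u) id (t3 (p *t v))).
  exact: tmap_mul_left_bilinear (@nmul_bilinear K A) (linear_comp t3_lin (tensr p)).
elim/tensor_ind: z => [u v|x y hx hy].
  by rewrite tliftE // inM_left_mull t3T mulrA -inM_tens.
by rewrite (linear_funD (tlift_linear b)) !(linear_funD (@inM_linear _ _)) hx hy mulrDl.
Qed.

Lemma t4_lift p z :
  inM (tlift (fun v u => tmap id (nmul^~ u) (t4 (v *t p))) z) = Delta p * inM z.
Proof.
have b : bilinear_map (fun v u => tmap id (nmul^~ u) (t4 (v *t p))).
  exact: tmap_mul_right_bilinear op_bil (linear_comp t4_lin (tensl p)).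
elim/tensor_ind: z => [u v|x y hx hy].
  by rewrite tliftE // inM_right_mulr t4T -mulrA -inM_tens.
by rewrite (linear_funD (tlift_linear b)) !(linear_funD (@inM_linear _ _)) hx hy mulrDr.
Qed.

Lemma t2_lift p z :
  inM (tlift (fun v u => tmap id (nmul u) (t2 (v *t p))) z) = inM z * Delta p.
Proof.
have b : bilinear_map (fun v u => tmap id (nmul u) (t2 (v *t p))).
  exact: tmap_mul_right_bilinear (@nmul_bilinear K A) (linear_comp t2_lin (tensl p)).
elim/tensor_ind: z => [u v|x y hx hy].
  by rewrite tliftE // inM_right_mull t2T mulrA -inM_tensC.
by rewrite (linear_funD (tlift_linear b)) !(linear_funD (@inM_linear _ _)) hx hy mulrDl.
Qed.

Variables phi psi : {scalar A}.
Hypotheses (phiI : left_integral Delta phi) (psiI : right_integral Delta psi).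

Let phi_lin : scalar phi. Proof. by move=> k x y; rewrite linearP. Qed.
Let psi_lin : scalar psi. Proof. by move=> k x y; rewrite linearP. Qed.

(** An integral is defined with a covering factor on both sides; non-degeneracy cancels the left
    one, [d]. The next three lemmas cancel one factor in the same way. *)
Lemma phi_t4 c a : rslice phi (t4 (c *t a)) = phi a *: c.
Proof.
apply/eqP; rewrite -subr_eq0; apply/eqP; apply: hA.2 => d.
rewrite (linear_funB _ _ (mull d)) (linear_funZ (mull d)).
have [x [xE xs]] := phiI.2 a d c; rewrite -xs -[slice_r phi x]/(rslice phi x).
rewrite -(rslice_tmap (h := id) _ (mull d) id_lin phi_lin); apply/eqP; rewrite subr_eq0.
by apply/eqP; congr (rslice _ _); apply: inj2; rewrite xE inM_left_mull t4T mulrA.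
Qed.

Lemma phi_t2 c a : rslice phi (t2 (c *t a)) = phi a *: c.
Proof.
apply/eqP; rewrite -subr_eq0; apply/eqP; apply: hA.1 => d.
rewrite (linear_funB _ _ (mulr d)) (linear_funZ (mulr d)).
have [x [xE xs]] := phiI.2 a c d; rewrite -xs -[slice_r phi x]/(rslice phi x).
rewrite -(rslice_tmap (h := id) _ (mulr d) id_lin phi_lin).
apply/eqP; rewrite subr_eq0.
by apply/eqP; congr (rslice _ _); apply: inj2; rewrite xE inM_left_mulr t2T.
Qed.

Lemma psi_t1 a b : lslice psi (t1 (a *t b)) = psi a *: b.
Proof.
apply/eqP; rewrite -subr_eq0; apply/eqP; apply: hA.2 => d.
rewrite (linear_funB _ _ (mull d)) (linear_funZ (mull d)).
have [x [xE xs]] := psiI.2 a b d; rewrite -xs -[slice_l psi x]/(lslice psi x).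
rewrite -(lslice_tmap (g := id) _ id_lin (mull d) psi_lin); apply/eqP; rewrite subr_eq0.
by apply/eqP; congr (lslice _ _); apply: inj2; rewrite xE inM_right_mull t1T mulrA.
Qed.

Lemma psi_t3 a b : lslice psi (t3 (a *t b)) = psi a *: b.
Proof.
apply/eqP; rewrite -subr_eq0; apply/eqP; apply: hA.1 => d.
rewrite (linear_funB _ _ (mulr d)) (linear_funZ (mulr d)).
have [x [xE xs]] := psiI.2 a d b; rewrite -xs -[slice_l psi x]/(lslice psi x).
rewrite -(lslice_tmap (g := id) _ id_lin (mulr d) psi_lin).
apply/eqP; rewrite subr_eq0.
by apply/eqP; congr (lslice _ _); apply: inj2; rewrite xE inM_right_mulr t3T.
Qed.

Let inM0 := linear_fun0 (@inM_linear K (tensor A A)).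
Let c12 := t2_t1_commute hA sepA t1E t2E coassoc.
Let c34 := t4_t3_commute hA sepA t1E t2E t3E t4E coassoc.

Lemma t1_bij : left_faithful phi -> right_faithful psi -> bijective t1.
Proof.
move=> phiF psiF.
apply: (@canonical_map_bij K A (@nmul K A) t1 t2 t4 phi psi) => //.
- exact: hA.2.
- by move=> c z z0; apply: inj2; rewrite t1_mull z0 inM0 mulr0.
- exact: psi_t1.
- exact: phi_t4.
- by move=> c p q; exact: t2_mulr.
- exact: t1_ract.
- by move=> p y q; apply: inj2; rewrite t1_lift !t4T DeltaM mulrA.
- exact: legs_commute_rslice.
Qed.

(** Passing to the opposite product turns [t3, t4, t2] into [t1, t2, t4] and exchanges left and
    right faithfulness. *)
Lemma t3_bij : right_faithful phi -> left_faithful psi -> bijective t3.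
Proof.
move=> phiF psiF.
apply: (@canonical_map_bij K A (fun a b => b ** a) t3 t4 t2 phi psi) => //.
- exact: hA.1.
- by move=> c z z0; apply: inj2; rewrite t3_mulr z0 inM0 mul0r.
- exact: psi_t3.
- exact: phi_t2.
- by move=> c p q; exact: t4_mull.
- by move=> p q r; exact: t3_lact.
- by move=> p y q; apply: inj2; rewrite t3_lift !t2T DeltaM mulrA.
- exact: legs_commute_rslice.
Qed.

(** Opposite product and opposite coproduct together: [psi] and [phi] exchange roles and so do the
    sides of faithfulness, so the assumptions are those of [t1_bij]. *)
Lemma t2_bij : left_faithful phi -> right_faithful psi -> bijective t2.
Proof.
move=> phiF psiF.
apply: (@flipped_canonical_map_bij K A (fun a b => b ** a) t2 t1 t3 psi phi) => //.
- exact: hA.1.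
- by move=> c z z0; apply: inj2; rewrite t2_mulr_right z0 inM0 mul0r.
- by move=> a b; exact: phi_t2.
- by move=> a b; exact: psi_t3.
- by move=> c p q; symmetry; exact: t2_mulr.
- by move=> p q r; exact: t2_lact.
- by move=> p y q; apply: inj2; rewrite t2_lift !t3T DeltaM mulrA.
- by move=> c p b; exact: legs_commute_lslice.
Qed.

(** The product is kept and the coproduct is flipped, so [psi] acts as the left integral and [phi]
    as the right one. *)
Lemma t4_bij : right_faithful phi -> left_faithful psi -> bijective t4.
Proof.
move=> phiF psiF.
apply: (@flipped_canonical_map_bij K A (@nmul K A) t4 t3 t1 psi phi) => //.
- exact: hA.2.
- by move=> c z z0; apply: inj2; rewrite t4_mull_right z0 inM0 mulr0.
- by move=> a b; exact: phi_t4.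
- by move=> a b; exact: psi_t1.
- by move=> c p q; symmetry; exact: t4_mull.
- by move=> p q r; exact: t4_ract.
- by move=> p y q; apply: inj2; rewrite t4_lift !t1T DeltaM mulrA.
- by move=> c p b; exact: legs_commute_lslice.
Qed.

End LarsonSweedler.

(** * From integrals and regularity to the theorem *)

Lemma left_faithful_dual_separates (K : fieldType) (A : nonUnitalAlgType K)
    (phi : {scalar A}) : left_faithful phi -> dual_separates A.
Proof.
move=> phiF a ha; apply: phiF => b; apply: (ha (fun a => phi (a ** b))) => k x y.
by rewrite (@nmul_linearl K A b) linearP.
Qed.

(** Regularity only asserts existence pointwise, so the maps are obtained by choice; their linearity
    follows from injectivity of [inM]. *)
Lemma regular_coproduct_lifts (K : fieldType) (A : nonUnitalAlgType K)
    (Delta : {linear A -> multiplier (tensor A A)}) :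
  non_degenerate A -> dual_separates A -> regular_coproduct Delta ->
  exists t1 t2 t3 t4 : tensor A A -> tensor A A,
    [/\ [/\ forall x, T1 Delta x = inM (t1 x), forall x, T2 Delta x = inM (t2 x),
            forall x, T3 Delta x = inM (t3 x) & forall x, T4 Delta x = inM (t4 x)]
      & covered_coassociative Delta t1 t2].
Proof.
move=> hA sepA [[_ hc] [/choice[t1 h1] /choice[t2 h2] /choice[t3 h3] /choice[t4 h4]]].
exists t1, t2, t3, t4; split; first by split.
apply: (coassociative_covered hA sepA h1 h2 h3 h4).
by case: hc => -[_ _ h]; [constructor 1|constructor 2|constructor 3|constructor 4].
Qed.

Theorem theorem2p9 (R : realType) (A : nonUnitalAlgType R[i])
    (Delta : {linear A -> multiplier (tensor A A)})
    (hA : non_degenerate A) (hDelta : regular_coproduct Delta) :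
  ((exists phi : {scalar A}, left_integral Delta phi /\ left_faithful phi) ->
   (exists psi : {scalar A}, right_integral Delta psi /\ right_faithful psi) ->
   multiplier_Hopf_algebra Delta) /\
  ((exists phi : {scalar A}, left_integral Delta phi /\ faithful phi) ->
   (exists psi : {scalar A}, right_integral Delta psi /\ faithful psi) ->
   regular_multiplier_Hopf_algebra Delta).
Proof.
have [cop [r1 r2 r3 r4]] := hDelta.
have mHa (phi psi : {scalar A}) : left_integral Delta phi -> left_faithful phi ->
    right_integral Delta psi -> right_faithful psi -> multiplier_Hopf_algebra Delta.
  move=> phiI phiF psiI psiF; have sepA := left_faithful_dual_separates phiF.
  have [t1 [t2 [t3 [t4 [[h1 h2 h3 h4] coassoc]]]]] :=
    regular_coproduct_lifts hA sepA hDelta.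
  split=> //.
    by exists t1 => //; exact: (t1_bij hA sepA cop.1 h1 h2 h4 coassoc phiI psiI).
  by exists t2 => //; exact: (t2_bij hA sepA cop.1 h1 h2 h3 coassoc phiI psiI).
split=> [[phi [phiI phiF]] [psi [psiI psiF]]|]; first exact: mHa phiI phiF psiI psiF.
move=> [phi [phiI [phiFl phiFr]]] [psi [psiI [psiFl psiFr]]].
have sepA := left_faithful_dual_separates phiFl.
have [t1 [t2 [t3 [t4 [[h1 h2 h3 h4] coassoc]]]]] :=
    regular_coproduct_lifts hA sepA hDelta.
split=> //; first exact: mHa phiI phiFl psiI psiFr.
  (* The other halves of faithfulness, right for [phi] and left for [psi], give [t3] and [t4]. *)
  by exists t3 => //; exact: (t3_bij hA sepA cop.1 h1 h2 h3 h4 coassoc phiI psiI).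
by exists t4 => //; exact: (t4_bij hA sepA cop.1 h1 h2 h3 h4 coassoc phiI psiI).
Qed.
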